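(* Let $\Lambda$ be a continuous bilinear form on $V$. Then for all $v\in V$ the series $\exp_{\star_\Lambda}(v)$ is absolutely convergent (in $\mathcal{S}^\bullet(V)^{\mathrm{cpl}}$) and $$\exp_{\star_\Lambda}(v)=\sum_{n=0}^\infty\frac{v^{\star_\Lambda n}}{n!}=\mathrm{e}^{\frac12\Lambda(v,v)}\exp_\vee(v).$$ Moreover, $$\exp_\vee(v)\star_\Lambda\exp_\vee(w)=\mathrm{e}^{\Lambda(v,w)}\exp_\vee(v+w)\qquad\text{and}\qquad\big\langle\exp_\vee(v)\,\big|\,\exp_\vee(w)\big\rangle_\alpha^\bullet=\mathrm{e}^{\langle v|w\rangle_\alpha}$$ hold for all $v,w\in V$ and all $\langle\cdot|\cdot\rangle_\alpha\in\mathcal{I}_V$. Finally, $\exp_\vee(v)^*=\exp_\vee(\overline v)$ for all $v\in V$ if $V$ is equipped with a continuous antilinear involution $\overline{\,\cdot\,}$.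
   Context: $V$ is a complex Hausdorff locally convex space whose topology is given by its continuous Hilbert seminorms: let $\mathcal{I}_V$ be the set of continuous positive Hermitian forms $\langle\cdot\,|\,\cdot\rangle_\alpha$ on $V$ (sesquilinear, antilinear in the first argument, Hermitian, positive semi-definite), put $\|v\|_\alpha:=\sqrt{\langle v|v\rangle_\alpha}$, and let $\mathcal{P}_V$ be the set of all these seminorms; it is assumed that $\mathcal{P}_V$ is cofinal in the set of all continuous seminorms on $V$. Let $\mathcal{T}^k_{\mathrm{alg}}(V)$ be the algebraic $k$-th tensor power ($\mathcal{T}^0_{\mathrm{alg}}(V)=\mathbb{C}$), $\mathcal{T}^\bullet_{\mathrm{alg}}(V)=\bigoplus_{k\ge 0}\mathcal{T}^k_{\mathrm{alg}}(V)$, and $\langle X\rangle_k$ the degree-$k$ component of $X$. Each $\langle\cdot|\cdot\rangle_\alpha\in\mathcal{I}_V$ is extended to a positive Hermitian form $\langle X|Y\rangle_\alpha^\bullet:=\sum_{k}\langle\langle X\rangle_k|\langle Y\rangle_k\rangle_\alpha^\bullet$ on $\mathcal{T}^\bullet_{\mathrm{alg}}(V)$, where $\langle x_1\otimes\cdots\otimes x_k|y_1\otimes\cdots\otimes y_k\rangle_\alpha^\bullet:=k!\prod_{m=1}^k\langle x_m|y_m\rangle_\alpha$; set $\|X\|_\alpha^\bullet:=\sqrt{\langle X|X\rangle_\alpha^\bullet}$. $\mathcal{T}^\bullet(V)$ is $\mathcal{T}^\bullet_{\mathrm{alg}}(V)$ with the locally convex topology defined by all seminorms $\|\cdot\|_\alpha^\bullet$,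 $\|\cdot\|_\alpha\in\mathcal{P}_V$. Let $\mathrm{Sym}^\bullet$ be the symmetrisation operator, $\mathrm{Sym}^\bullet(x_1\otimes\cdots\otimes x_k)=\frac1{k!}\sum_{\sigma\in\mathfrak{S}_k}x_{\sigma(1)}\otimes\cdots\otimes x_{\sigma(k)}$, and let $\mathcal{S}^\bullet(V)$ be its image (the symmetric tensors) with the subspace topology; $\mathcal{S}^\bullet(V)^{\mathrm{cpl}}$ is its completion. $X\vee Y:=\mathrm{Sym}^\bullet(X\otimes Y)$ is the undeformed product. For a continuous bilinear form $\Lambda$ on $V$, let $P_\Lambda$ be the linear endomorphism of $\mathcal{T}^\bullet(V)\otimes\mathcal{T}^\bullet(V)$ (outer tensor product) with $P_\Lambda\big((x_1\otimes\cdots\otimes x_k)\otimes(y_1\otimes\cdots\otimes y_\ell)\big)=k\ell\,\Lambda(x_k,y_1)\,(x_1\otimes\cdots\otimes x_{k-1})\otimes(y_2\otimes\cdots\otimes y_\ell)$ for $k,\ell\ge1$, and zero if $k=0$ or $\ell=0$ (the tensor sign between the two brackets is the outer one). With $\mu_\vee(X\otimes Y):=\mathrm{Sym}^\bullet(X\otimes Y)$ (product in the tensor algebra on the right), $X\star_\Lambda Y:=\sum_{t=0}^\infty\frac1{t!}\mu_\vee\big((P_\Lambda)^t(X\otimes Y)\big)$ for $X,Y\in\mathcal{S}^\bullet(V)$. The $^*$-involution induced by $\overline{\,\cdot\,}$ is the antilinear map with $(x_1\otimes\cdots\otimes x_k)^*:=\overline{x_k}\otimes\cdots\otimes\overline{x_1}$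 (complex conjugation on scalars). The products $\star_\Lambda$ and $\vee=\star_0$, the forms $\langle\cdot|\cdot\rangle_\alpha^\bullet$ and $^*$ are continuous and are extended to $\mathcal{S}^\bullet(V)^{\mathrm{cpl}}$ by continuity. For a product $\star$, $\exp_\star(X):=\sum_{n=0}^\infty\frac1{n!}X^{\star n}$, where $X^{\star n}$ is the $n$-th power with respect to $\star$. Absolute convergence means convergence of $\sum_n\|\cdot\|_\alpha^\bullet$ of the terms for every $\|\cdot\|_\alpha\in\mathcal{P}_V$. *)

(* Defs.v *)
From HB Require Import structures.
From mathcomp Require Import all_boot all_order all_algebra perm generic_quotient ring.
From mathcomp Require Import ring_quotient freeg.
From mathcomp Require Import all_classical all_reals all_analysis.

Set Implicit Arguments.
Unset Strict Implicit.
Unset Printing Implicit Defensive.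

Import Order.TTheory GRing.Theory Num.Theory numFieldNormedType.Exports.

Local Open Scope classical_set_scope.
Local Open Scope ring_scope.
Local Open Scope quotient_scope.

Section Presentation.
Context (K : fieldType) (A : choiceType) (rel : set {freeg A / K}).

Inductive relspan : {freeg A / K} -> Prop :=
| relspan0 : relspan 0
| relspanZD c r x : rel r -> relspan x -> relspan (c *: r + x).

Definition relspan_pred : {pred {freeg A / K}} := [pred x | `[< relspan x >]].

Lemma relspanZ c x : relspan x -> relspan (c *: x).
Proof.
elim=> [|d r y rr _ IH]; first by rewrite scaler0; constructor.
by rewrite scalerDr scalerA; apply: relspanZD.
Qed.

Lemma relspanD x y : relspan x -> relspan y -> relspan (x + y).
Proof.
move=> + sy; elim=> [|c r z rr _ IH]; first by rewrite add0r.
by rewrite -addrA; apply: relspanZD.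
Qed.

Lemma relspan_predP x : reflect (relspan x) (x \in relspan_pred).
Proof. exact: asboolP. Qed.

Lemma relspan_zmod_closed : zmod_closed relspan_pred.
Proof.
split=> [|x y]; first by apply/relspan_predP; exact: relspan0.
move=> /relspan_predP sx /relspan_predP sy; apply/relspan_predP.
by apply: relspanD => //; rewrite -scaleN1r; exact: relspanZ.
Qed.

HB.instance Definition _ :=
  GRing.isZmodClosed.Build _ relspan_pred relspan_zmod_closed.

Definition presmod : Type := Quotient.quot relspan_pred.

HB.instance Definition _ := Choice.on presmod.
HB.instance Definition _ := GRing.Zmodule.on presmod.

Definition prespi : {freeg A / K} -> presmod := \pi_(Quotient.quot relspan_pred).
Definition presrepr : presmod -> {freeg A / K} :=
  fun x => repr (x : Quotient.quot relspan_pred).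

Lemma presreprK x : prespi (presrepr x) = x.
Proof. exact: reprK. Qed.

Lemma prespi_eq x y : relspan (x - y) -> prespi x = prespi y.
Proof.
move=> sxy; apply/eqP; rewrite /prespi.
by rewrite -[_ == _]Quotient.idealrBE; apply/relspan_predP.
Qed.

Lemma presreprP x : relspan (presrepr (prespi x) - x).
Proof.
apply/relspan_predP; have := Quotient.idealrBE relspan_pred (presrepr (prespi x)) x.
by move=> ->; rewrite [\pi _]reprK.
Qed.

Lemma prespiD x y : prespi (x + y) = prespi x + prespi y.
Proof. exact: (raddfD \pi_(Quotient.quot relspan_pred)). Qed.

Lemma prespi0 : prespi 0 = 0.
Proof. exact: (raddf0 \pi_(Quotient.quot relspan_pred)). Qed.

Definition presscale (c : K) (x : presmod) : presmod := prespi (c *: presrepr x).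

Lemma prespiZ c x : prespi (c *: x) = presscale c (prespi x).
Proof.
apply: prespi_eq; rewrite -scalerBr; apply: relspanZ.
by rewrite -opprB -scaleN1r; apply: relspanZ; exact: presreprP.
Qed.

Lemma presscaleA a b x : presscale a (presscale b x) = presscale (a * b) x.
Proof. by rewrite -[x]presreprK -!prespiZ scalerA. Qed.

Lemma presscale1 : left_id 1 presscale.
Proof. by move=> x; rewrite -[x]presreprK -!prespiZ scale1r. Qed.

Lemma presscaleDr : right_distributive presscale +%R.
Proof.
by move=> a x y; rewrite -[x]presreprK -[y]presreprK -prespiD -!prespiZ scalerDr
  prespiD.
Qed.

Lemma presscaleDl x : {morph presscale^~ x : a b / a + b}.
Proof. by move=> a b; rewrite -[x]presreprK -!prespiZ scalerDl prespiD. Qed.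

HB.instance Definition _ := GRing.Zmodule_isLmodule.Build K presmod
  presscaleA presscale1 presscaleDr presscaleDl.

Definition presgen (a : A) : presmod := prespi << a >>.

(* The linear map with presgen a |-> f a; only meaningful when f respects the
   relations, see preslift_linear and presliftE *)
Definition preslift (W : lmodType K) (f : A -> W) (x : presmod) : W :=
  fglift f (presrepr x).

Section Lift.
Context (W : lmodType K) (f : A -> W).

Lemma fgliftD x y : fglift f (x + y) = fglift f x + fglift f y.
Proof.
by rewrite -[y in LHS]opprK lift_is_additive -[- y]add0r lift_is_additive
  -[0](subrr (0 : {freeg A / K})) lift_is_additive subrr sub0r opprK.
Qed.

Lemma fgliftZ c x : fglift f (c *: x) = c *: fglift f x.
Proof.
have fl0 : fglift f 0 = 0.
  by rewrite -[0](subrr (0 : {freeg A / K})) lift_is_additive subrr.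
have fls (s : seq (K * A)) : fglift f (\sum_(i <- s) << i.1 *g i.2 >>) =
    \sum_(i <- s) i.1 *: f i.2.
  elim: s => [|i s IH]; first by rewrite !big_nil.
  by rewrite !big_cons fgliftD IH liftU.
have xE : x = \sum_(i <- [seq (coeff a x, a) | a <- dom x]) << i.1 *g i.2 >>.
  by rewrite big_map /= freeg_sumE.
have -> : c *: x =
    \sum_(i <- [seq (c * coeff a x, a) | a <- dom x]) << i.1 *g i.2 >>.
  by rewrite big_map.
rewrite [in RHS]xE !fls !big_map scaler_sumr.
by apply: eq_bigr => i _; rewrite scalerA.
Qed.

Hypothesis frel : forall r, rel r -> fglift f r = 0.

Lemma fglift_relspan x : relspan x -> fglift f x = 0.
Proof.
elim=> [|c r y rr _ IH]; first by rewrite -(scale0r 0) fgliftZ scale0r.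
by rewrite fgliftD fgliftZ frel // IH scaler0 addr0.
Qed.

Lemma preslift_pi x : preslift f (prespi x) = fglift f x.
Proof.
have := fglift_relspan (presreprP x).
rewrite -scaleN1r fgliftD fgliftZ scaleN1r => /eqP.
by rewrite subr_eq0 => /eqP.
Qed.

Lemma preslift_linear : linear (preslift f).
Proof.
move=> c x y; rewrite -[x]presreprK -[y]presreprK -[c *: _]prespiZ -prespiD.
by rewrite !preslift_pi fgliftD fgliftZ.
Qed.

Lemma presliftE a : preslift f (presgen a) = f a.
Proof. by rewrite preslift_pi liftU scale1r. Qed.

End Lift.

Lemma presmod_spanP (x : presmod) :
  exists s : seq (K * A), x = \sum_(i <- s) i.1 *: presgen i.2.
Proof.
exists [seq (coeff a (presrepr x), a) | a <- dom (presrepr x)].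
rewrite big_map -[x in LHS]presreprK -[presrepr x in LHS]freeg_sumE.
elim: (dom _) => [|a s IH]; first by rewrite !big_nil; exact: prespi0.
rewrite !big_cons prespiD IH /presgen; congr (_ + _).
rewrite -[_ *: _ in RHS]prespiZ; congr prespi.
by apply/eqP/freeg_eqP => b; rewrite coeffZ !coeffU mul1r.
Qed.

End Presentation.

Lemma linear_map0 (K : fieldType) (U W : lmodType K) (g : U -> W) :
  linear g -> g 0 = 0.
Proof. by move=> gl; have := gl (-1) 0 0; rewrite !scaleN1r oppr0 addr0 addNr. Qed.

Section OuterTensor.
Context (K : fieldType) (U W : lmodType K).

Definition ot_rel : set {freeg (U * W) / K} :=
  [set r | (exists a u u' w,
             r = << (a *: u + u', w) >> - (a *: << (u, w) >> + << (u', w) >>)) \/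
           (exists a u w w',
             r = << (u, a *: w + w') >> - (a *: << (u, w) >> + << (u, w') >>))].

Definition otensor : Type := presmod ot_rel.
HB.instance Definition _ := GRing.Lmodule.on otensor.

Definition otimes (u : U) (w : W) : otensor := presgen ot_rel (u, w).

(* The linear map with otimes u w |-> f u w, when f is bilinear *)
Definition olift (X : lmodType K) (f : U -> W -> X) : otensor -> X :=
  preslift (fun uw => f uw.1 uw.2).

Lemma otimesDl a u u' w : otimes (a *: u + u') w = a *: otimes u w + otimes u' w.
Proof.
rewrite /otimes /presgen -[_ *: prespi _ _]prespiZ -prespiD; apply: prespi_eq.
rewrite -[X in relspan _ X]addr0 -[_ - _]scale1r.
by apply: relspanZD; [left; exists a, u, u', w | exact: relspan0].
Qed.

Lemma otimesDr a u w w' : otimes u (a *: w + w') = a *: otimes u w + otimes u w'.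
Proof.
rewrite /otimes /presgen -[_ *: prespi _ _]prespiZ -prespiD; apply: prespi_eq.
rewrite -[X in relspan _ X]addr0 -[_ - _]scale1r.
by apply: relspanZD; [right; exists a, u, w, w' | exact: relspan0].
Qed.

Section Lift.
Context (X : lmodType K) (f : U -> W -> X).
Hypothesis fl : forall w, linear (f^~ w).
Hypothesis fr : forall u, linear (f u).

Let frel r : ot_rel r -> fglift (fun uw => f uw.1 uw.2) r = 0.
Proof.
case=> [[a [u [u' [w ->]]]]|[a [u [w [w' ->]]]]];
  by rewrite lift_is_additive fgliftD fgliftZ !liftU !scale1r /= (fl, fr) subrr.
Qed.

Lemma olift_linear : linear (olift f).
Proof. exact: preslift_linear frel. Qed.

Lemma oliftE u w : olift f (otimes u w) = f u w.
Proof. exact: presliftE frel _. Qed.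

End Lift.

End OuterTensor.

Section TensorAlgebra.
Context (K : fieldType) (V : lmodType K).

(* The direct sum of the tensor powers of V, presented on all words at once:
   the word [:: x_1; ..; x_k] stands for the product of x_1, .., x_k, and the
   relations, being homogeneous, are the multilinearity in each degree k *)
Definition word_rel : set {freeg (seq V) / K} :=
  [set r | exists s t a x y, r = << s ++ (a *: x + y) :: t >> -
                     (a *: << s ++ x :: t >> + << s ++ y :: t >>)].

Definition talg : Type := presmod word_rel.
HB.instance Definition _ := GRing.Lmodule.on talg.

Definition tens (s : seq V) : talg := presgen word_rel s.

Definition multilinear (W : lmodType K) (f : seq V -> W) :=
  forall s t a x y,
    f (s ++ (a *: x + y) :: t) = a *: f (s ++ x :: t) + f (s ++ y :: t).

(* The linear map with tens s |-> f s, when f is multilinear *)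
Definition tlift (W : lmodType K) (f : seq V -> W) : talg -> W := preslift f.

Lemma tens_multilinear : multilinear tens.
Proof.
move=> s t a x y.
rewrite /tens /presgen -[_ *: prespi _ _]prespiZ -prespiD; apply: prespi_eq.
rewrite -[X in relspan _ X]addr0 -[_ - _]scale1r.
by apply: relspanZD; [exists s, t, a, x, y | exact: relspan0].
Qed.

Lemma talg_ind (P : talg -> Prop) : P 0 ->
  (forall c s X, P X -> P (c *: tens s + X)) -> forall X, P X.
Proof.
move=> P0 PS X; have [l ->] := presmod_spanP X.
elim: l => [|[c s] l IH]; first by rewrite big_nil.
by rewrite big_cons; exact: PS.
Qed.

Section Lift.
Context (W : lmodType K) (f : seq V -> W).
Hypothesis fm : multilinear f.

Let frel r : word_rel r -> fglift f r = 0.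
Proof.
move=> [s [t [a [x [y ->]]]]].
by rewrite lift_is_additive fgliftD fgliftZ !liftU !scale1r fm subrr.
Qed.

Lemma tlift_linear : linear (tlift f).
Proof. exact: preslift_linear frel. Qed.

Lemma tliftE s : tlift f (tens s) = f s.
Proof. exact: presliftE frel _. Qed.

End Lift.

(* Lifting a map of two words, one argument at a time *)
Definition tlift2 (W : lmodType K) (f : seq V -> seq V -> W) (X Y : talg) : W :=
  tlift (fun s => tlift (f s) Y) X.

Section Lift2.
Context (W : lmodType K) (f : seq V -> seq V -> W).
Hypothesis fl : forall t, multilinear (f^~ t).
Hypothesis fr : forall s, multilinear (f s).

Lemma tlift2_multilinear Y : multilinear (fun s => tlift (f s) Y).
Proof.
move=> s t a x y; elim/talg_ind: Y => [|c w Y IH].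
  by rewrite !(linear_map0 (tlift_linear _)) // scaler0 addr0.
rewrite !tlift_linear // !tliftE // IH fl !scalerDr !scalerA mulrC.
by rewrite addrACA.
Qed.

Lemma tlift2_linear_l Y : linear (tlift2 f ^~ Y).
Proof. exact/tlift_linear/tlift2_multilinear. Qed.

Lemma tlift2_linear_r X : linear (tlift2 f X).
Proof.
move=> a Y Z; elim/talg_ind: X => [|c w X IH].
  by rewrite !(linear_map0 (tlift2_linear_l _)) scaler0 addr0.
rewrite !tlift2_linear_l IH ![tlift2 f (tens w) _]tliftE;
  try exact: tlift2_multilinear.
by rewrite tlift_linear // !scalerDr !scalerA mulrC addrACA.
Qed.

Lemma tlift2E s t : tlift2 f (tens s) (tens t) = f s t.
Proof. by rewrite /tlift2 !tliftE //; exact: tlift2_multilinear. Qed.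

End Lift2.

Definition tmul : talg -> talg -> talg := tlift2 (fun s t => tens (s ++ t)).

Lemma tmulE s t : tmul (tens s) (tens t) = tens (s ++ t).
Proof.
apply: tlift2E => [u|u] s1 s2 a x y; last by rewrite !catA tens_multilinear.
by rewrite -!catA !cat_cons tens_multilinear.
Qed.

Definition sym_word (s : seq V) : talg :=
  ((size s)`!%:R)^-1 *:
    \sum_(p : 'S_(size s)) tens [seq s`_(p i) | i <- enum 'I_(size s)].

Lemma sym_word_multilinear : multilinear sym_word.
Proof.
move=> s t a x y; rewrite /sym_word.
have sz z : size (s ++ z :: t) = (size s + size t).+1.
  by rewrite size_cat /= addnS.
rewrite !sz [X in _ = X + _]scalerA [a * _]mulrC -scalerA -scalerDr; congr (_ *: _).
rewrite scaler_sumr -big_split; apply: eq_bigr => p _ /=.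
have lts : (size s < (size s + size t).+1)%N by rewrite ltnS leq_addr.
pose k := Ordinal lts; pose j := (p^-1)%g k.
have nthE z : [seq (s ++ z :: t)`_(p i) | i <- enum 'I_(size s + size t).+1] =
    [seq (if i == j then z else (s ++ 0 :: t)`_(p i)) | i <- enum 'I_(size s + size t).+1].
  apply: eq_map => i; rewrite /j -(inj_eq (@perm_inj _ p)) permKV !nth_cat.
  have [->|ki] := eqVneq (p i) k; first by rewrite /= ltnn subnn.
  have {}ki : (val (p i) != size s)%N by apply: contra ki => /eqP e; apply/eqP/val_inj.
  by case: ltngtP ki => //= lsi _; move: lsi; rewrite -subn_gt0; case: (_ - _)%N.
rewrite !nthE.
have := enum_uniq 'I_(size s + size t).+1.
case/splitPr: (mem_enum 'I_(size s + size t).+1 j) => e1 e2.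
rewrite cat_uniq /= => /and4P[_ /norP[je1 _] je2 _].
have mapE z (e : seq 'I_(size s + size t).+1) : j \notin e ->
    [seq (if i == j then z else (s ++ 0 :: t)`_(p i)) | i <- e] =
    [seq (s ++ 0 :: t)`_(p i) | i <- e].
  move=> je; apply/eq_in_map => i ie.
  by case: eqP ie => // ->; rewrite (negbTE je).
by rewrite !map_cat /= !eqxx !mapE // tens_multilinear.
Qed.

Definition Sym : talg -> talg := tlift sym_word.

Lemma Sym_linear : linear Sym.
Proof. exact/tlift_linear/sym_word_multilinear. Qed.

HB.instance Definition _ := GRing.isLinear.Build K talg talg _ Sym Sym_linear.

Lemma SymE s : Sym (tens s) = sym_word s.
Proof. exact/tliftE/sym_word_multilinear. Qed.

Lemma Sym_tens0 : Sym (tens [::]) = tens [::].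
Proof.
rewrite SymE /sym_word /= invr1 scale1r (bigD1 (1%g : 'S_0)) //= big1 ?addr0.
  by congr tens; apply: size0nil; rewrite size_map size_enum_ord.
by move=> p /eqP[]; apply/permP; case.
Qed.

Lemma Sym_tens1 v : Sym (tens [:: v]) = tens [:: v].
Proof.
rewrite SymE /sym_word /= invr1 scale1r (bigD1 (1%g : 'S_1)) //= big1 ?addr0.
  congr tens; rewrite -[enum _]/(enum 'I_1) enum_ordSl /= perm1 /=.
  by rewrite (size0nil (size_enum_ord 0)).
by move=> p /eqP[]; apply/permP => i; rewrite perm1 [LHS]ord1 [RHS]ord1.
Qed.

Definition symtensor : {pred talg} := [pred X | `[< exists Y, X = Sym Y >]].

Lemma symtensorP X : reflect (exists Y, X = Sym Y) (X \in symtensor).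
Proof. exact: asboolP. Qed.

Lemma symtensor_submod_closed : submod_closed symtensor.
Proof.
split=> [|a X Y]; first by apply/symtensorP; exists 0; rewrite linear0.
move=> /symtensorP[X' ->] /symtensorP[Y' ->]; apply/symtensorP.
by exists (a *: X' + Y'); rewrite linearP.
Qed.

HB.instance Definition _ :=
  GRing.isSubmodClosed.Build K talg symtensor symtensor_submod_closed.

Record symt : Type := SymT { symval : talg; _ : symval \in symtensor }.

HB.instance Definition _ := [isSub for symval].
HB.instance Definition _ := [Choice of symt by <:].
HB.instance Definition _ := [SubChoice_isSubLmodule of symt by <:].

Lemma Sym_symtensor X : Sym X \in symtensor.
Proof. by apply/symtensorP; exists X. Qed.

Definition symS (X : talg) : symt := SymT (Sym_symtensor X).

Definition sone : symt := symS (tens [::]).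

Definition svec (v : V) : symt := symS (tens [:: v]).

Lemma val_sone : \val sone = tens [::]. Proof. exact: Sym_tens0. Qed.

Lemma val_svec v : \val (svec v) = tens [:: v]. Proof. exact: Sym_tens1. Qed.

Definition svee (X Y : symt) : symt := symS (tmul (\val X) (\val Y)).

Definition mu_vee : otensor talg talg -> symt :=
  olift (fun X Y => symS (tmul X Y)).

Section Star.
Context (Lam : V -> V -> K).

Definition P_word (s t : seq V) : otensor talg talg :=
  match s, t with
  | x :: s', y :: t' => ((size s * size t)%:R * Lam (last x s') y) *:
                          otimes (tens (belast x s')) (tens t')
  | _, _ => 0
  end.

Definition P_Lambda : otensor talg talg -> otensor talg talg :=
  olift (tlift2 P_word).

Section PE.
Hypothesis Ll : forall w a u v, Lam (a *: u + v) w = a * Lam u w + Lam v w.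
Hypothesis Lr : forall w a u v, Lam w (a *: u + v) = a * Lam w u + Lam w v.

Lemma P_word_rcons s x y t :
  P_word (rcons s x) (y :: t) =
    (((size s).+1 * (size t).+1)%:R * Lam x y) *: otimes (tens s) (tens t).
Proof. by case: s => [|z s] /=; rewrite ?last_rcons ?belast_rcons ?size_rcons. Qed.

Lemma P_word_nilr s : P_word s [::] = 0. Proof. by case: s. Qed.

Lemma P_word_multilinear_l t : multilinear (P_word^~ t).
Proof.
case: t => [|y t] s1 s2 a u v /=; first by rewrite !P_word_nilr scaler0 addr0.
case/lastP: s2 => [|s2 w].
  by rewrite !cats1 !P_word_rcons Ll mulrDr scalerDl scalerA mulrCA.
rewrite -!rcons_cons -!rcons_cat !P_word_rcons tens_multilinear otimesDl.
by rewrite !size_cat /= scalerDr !scalerA [_ * a]mulrC.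
Qed.

Lemma P_word_multilinear_r s : multilinear (P_word s).
Proof.
case/lastP: s => [|s x] t1 t2 a u v; first by rewrite /= scaler0 addr0.
case: t1 => [|z t1] /=; rewrite !P_word_rcons.
  by rewrite Lr mulrDr scalerDl scalerA mulrCA.
by rewrite tens_multilinear otimesDr !size_cat /= scalerDr !scalerA [_ * a]mulrC.
Qed.

Lemma P_LambdaE s t : P_Lambda (otimes (tens s) (tens t)) = P_word s t.
Proof.
rewrite /P_Lambda oliftE ?tlift2E // => *.
- exact: P_word_multilinear_l.
- exact: P_word_multilinear_r.
- exact/tlift2_linear_l/P_word_multilinear_r/P_word_multilinear_l.
- exact/tlift2_linear_r/P_word_multilinear_r/P_word_multilinear_l.
Qed.

End PE.

(* P_Lambda lowers degrees, so only finitely many terms are non-zero *)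
Definition star (X Y : symt) : symt :=
  \sum_(t \in [set: nat])
    (t`!%:R)^-1 *: mu_vee (iter t P_Lambda (otimes (\val X) (\val Y))).

End Star.

End TensorAlgebra.

(* The complex conjugate of a complex vector space: antilinear maps into W are
   linear maps into conjmod W *)
Definition conjmod (C : numClosedFieldType) (W : lmodType C) : Type := W.

Section ConjMod.
Context (C : numClosedFieldType) (W : lmodType C).

HB.instance Definition _ := GRing.Zmodule.on (conjmod W).

Definition conjscale (c : C) (w : conjmod W) : conjmod W :=
  c^* *: (w : W).

Lemma conjscaleA a b w : conjscale a (conjscale b w) = conjscale (a * b) w.
Proof. by rewrite /conjscale scalerA rmorphM. Qed.

Lemma conjscale1 : left_id 1 conjscale.
Proof. by move=> w; rewrite /conjscale rmorph1 scale1r. Qed.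

Lemma conjscaleDr : right_distributive conjscale +%R.
Proof. by move=> c v w; rewrite /conjscale -scalerDr. Qed.

Lemma conjscaleDl w : {morph conjscale^~ w : a b / a + b}.
Proof. by move=> a b; rewrite /conjscale rmorphD scalerDl. Qed.

HB.instance Definition _ := GRing.Zmodule_isLmodule.Build C (conjmod W)
  conjscaleA conjscale1 conjscaleDr conjscaleDl.

End ConjMod.

Section HermitianForms.
Context (C : numClosedFieldType) (V : tvsType C).

Record hform : Type := HForm {
  hform_fun :> V -> V -> C;
  hform_antilinear : forall w a u v,
    hform_fun (a *: u + v) w = a^* * hform_fun u w + hform_fun v w;
  hform_linear : forall u a v w,
    hform_fun u (a *: v + w) = a * hform_fun u v + hform_fun u w;
  hform_hermitian : forall u v, hform_fun u v = (hform_fun v u)^*;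
  hform_ge0 : forall v, 0 <= hform_fun v v;
  hform_continuous : continuous (fun p : V * V => hform_fun p.1 p.2 : C^o)
}.

Definition hnorm (al : hform) (v : V) : C := sqrtC (al v v).

Definition is_seminorm (p : V -> C) : Prop :=
  [/\ forall v, 0 <= p v, forall u v, p (u + v) <= p u + p v &
      forall c v, p (c *: v) = `|c| * p v].

Definition hilbert_seminorms_cofinal : Prop :=
  forall p : V -> C^o, is_seminorm p -> continuous p ->
    exists al : hform, forall v, p v <= hnorm al v.

Definition form_word (al : hform) (s t : seq V) : C :=
  if size s == size t
  then (size s)`!%:R * \prod_(xy <- zip s t) al xy.1 xy.2 else 0.

Definition tform (al : hform) (X Y : talg V) : C :=
  tlift (fun s => tlift (W := C^o) (form_word al s) Y : conjmod C^o) X.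

Section FormE.
Variable al : hform.

Lemma form_wordC s t : form_word al s t = (form_word al t s)^*.
Proof.
rewrite /form_word eq_sym; case: eqP => [e|_]; last by rewrite rmorph0.
rewrite rmorphM rmorph_nat e; congr (_ * _); rewrite rmorph_prod /=.
elim: s t e => [|x s IH] [|y t] //= e; first by rewrite !big_nil.
by rewrite !big_cons (IH _ (succn_inj e)) /= hform_hermitian.
Qed.

Lemma form_word_multilinear s : multilinear (form_word al s : seq V -> C^o).
Proof.
move=> t1 t2 a x y; rewrite /form_word !size_cat /=.
case: eqP => [e|_]; last by rewrite scaler0 addr0.
have [s1 [z [s2 [es e1]]]] : exists s1 z s2, s = s1 ++ z :: s2 /\ size s1 = size t1.
  exists (take (size t1) s), s`_(size t1), (drop (size t1).+1 s).
  have lt : (size t1 < size s)%N by rewrite e addnS ltnS leq_addr.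
  by rewrite -drop_nth // cat_take_drop size_take lt.
rewrite es !zip_cat //= !big_cat !big_cons /= hform_linear.
by rewrite /GRing.scale /=; ring.
Qed.

Lemma form_word_antilinear t :
  multilinear (form_word al ^~ t : seq V -> conjmod C^o).
Proof.
move=> s1 s2 a x y; rewrite [LHS]form_wordC form_word_multilinear.
by rewrite rmorphD /= [_ *: _]/(_ * _) rmorphM /= -!form_wordC.
Qed.

Lemma tform_antilinear_word Y : multilinear
  (fun s => tlift (W := C^o) (form_word al s) Y : conjmod C^o).
Proof.
move=> s t a x y; elim/talg_ind: Y => [|c w Y IH].
  rewrite !(linear_map0 (tlift_linear (form_word_multilinear _))).
  by rewrite [in RHS](_ : a *: _ = 0) ?addr0 //; exact: scaler0.
rewrite !(tlift_linear (form_word_multilinear _)) IH.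
rewrite !(tliftE (form_word_multilinear _)) form_word_antilinear.
by rewrite /GRing.scale /= /conjscale /GRing.scale /=; ring.
Qed.

Lemma tformE s t : tform al (tens s) (tens t) = form_word al s t.
Proof.
rewrite /tform (tliftE (tform_antilinear_word _)).
exact: tliftE (form_word_multilinear _) _.
Qed.

Lemma tform_antilinear a X Y Z :
  tform al (a *: X + Y) Z = a^* * tform al X Z + tform al Y Z.
Proof. exact: (tlift_linear (tform_antilinear_word Z)). Qed.

Lemma tform_linear X a Y Z :
  tform al X (a *: Y + Z) = a * tform al X Y + tform al X Z.
Proof.
elim/talg_ind: X => [|c w X IH].
  have t0 W : tform al 0 W = 0.
    exact: (linear_map0 (tlift_linear (tform_antilinear_word W))).
  by rewrite !t0 mulr0 addr0.
rewrite !tform_antilinear IH.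
rewrite /tform !(tliftE (tform_antilinear_word _)).
by rewrite (tlift_linear (form_word_multilinear _)) /GRing.scale /=; ring.
Qed.

End FormE.

Definition symform (al : hform) (X Y : symt V) : C :=
  tform al (\val X) (\val Y).

Definition symnorm (al : hform) (X : symt V) : C := sqrtC (symform al X X).

(* Neighbourhoods of 0 for the topology of all the seminorms symnorm al *)
Definition sym_nbhs0 (A : set (symt V)) : Prop :=
  exists (n : nat) (al : 'I_n -> hform) (e : C),
    0 < e /\ forall X, (forall k, symnorm (al k) X < e) -> A X.

Record cinvolution : Type := CInvolution {
  cinv_fun :> V -> V;
  cinv_antilinear : forall a u v,
    cinv_fun (a *: u + v) = a^* *: cinv_fun u + cinv_fun v;
  cinvK : involutive cinv_fun;
  cinv_continuous : continuous cinv_fun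
}.

Definition tstar (bar : cinvolution) (X : talg V) : talg V :=
  tlift (fun s => tens (rev (map bar s)) : conjmod (talg V)) X.

Section StarE.
Variable bar : cinvolution.

Lemma tstar_word_multilinear :
  multilinear (fun s => tens (rev (map bar s)) : conjmod (talg V)).
Proof.
move=> s t a x y; rewrite !map_cat !rev_cat /= !rev_cons cinv_antilinear.
by rewrite !cat_rcons tens_multilinear.
Qed.

Lemma tstarE s : tstar bar (tens s) = tens (rev (map bar s)).
Proof. exact: (tliftE tstar_word_multilinear). Qed.

Lemma tstar_antilinear a X Y :
  tstar bar (a *: X + Y) = a^* *: tstar bar X + tstar bar Y.
Proof. exact: (tlift_linear tstar_word_multilinear). Qed.

Lemma Sym_tstar X : Sym (tstar bar X) = tstar bar (Sym X).
Proof.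
have t0 : tstar bar 0 = 0.
  exact: (linear_map0 (tlift_linear tstar_word_multilinear)).
have tZ a Y : tstar bar (a *: Y) = a^* *: tstar bar Y.
  by rewrite -[a *: Y]addr0 tstar_antilinear t0 addr0.
have tD Y Z : tstar bar (Y + Z) = tstar bar Y + tstar bar Z.
  by rewrite -[Y]scale1r tstar_antilinear rmorph1 !scale1r.
elim/talg_ind: X => [|c s X IH]; first by rewrite t0 !linear0 t0.
rewrite tstar_antilinear !linearP /= IH tstar_antilinear tstarE !SymE.
congr (_ *: _ + _); rewrite /sym_word size_rev size_map tZ fmorphV rmorph_nat.
congr (_ *: _); rewrite (big_morph _ tD t0).
pose rp : 'S_(size s) := perm (@rev_ord_inj (size s)).
rewrite (reindex_inj (mulgI rp)) (reindex_inj (mulIg rp)) /=.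
apply: eq_bigr => p _; rewrite tstarE; congr tens.
have nthE (f : 'I_(size s) -> V) k (lk : (k < size s)%N) :
    [seq f i | i <- enum 'I_(size s)]`_k = f (Ordinal lk).
  rewrite (nth_map (Ordinal lk)) ?size_enum_ord //; congr f.
  exact: (nth_ord_enum _ (Ordinal lk)).
apply: (@eq_from_nth _ 0) => [|k]; first by rewrite size_rev !size_map.
rewrite size_map size_enum_ord => lk.
have lk' : (size s - k.+1 < size s)%N by rewrite ltn_subrL /= (leq_ltn_trans _ lk).
rewrite nthE nth_rev ?size_map // [RHS]nth_rev; last first.
  by rewrite 2!size_map size_enum_ord.
rewrite -map_comp size_map size_enum_ord [RHS]nthE (nth_map 0) /=; last first.
  by rewrite ltn_subrL /= (leq_ltn_trans _ lk).
congr (bar s`_ _); rewrite !permM !permE /=.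
have -> : rev_ord (Ordinal lk) = Ordinal lk' by exact: val_inj.
by rewrite subnSK // subKn // ltnW.
Qed.

Lemma tstar_symtensor (X : symt V) : tstar bar (\val X) \in @symtensor C V.
Proof.
have /symtensorP[Y ->] := valP X; apply/symtensorP.
by exists (tstar bar Y); rewrite Sym_tstar.
Qed.

Definition symstar (X : symt V) : symt V := SymT (tstar_symtensor X).

End StarE.

End HermitianForms.

Section Completion.
Context (C : numClosedFieldType) (V E : tvsType C).

(* A tvsType carries an arbitrary uniformity inducing its topology, so Cauchy
   filters are taken here with respect to translations *)
Definition tvs_cauchy (F : set_system E) : Prop :=
  forall U : set E, nbhs (0 : E) U ->
    exists2 A, F A & forall x y, A x -> A y -> U (x - y).

(* E, with the linear map iota, is the completion of the locally convex space
   symt V; the embedding condition is stated at 0, which suffices as iota is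
   linear *)
Record is_completion (iota : {linear symt V -> E}) : Prop := IsCompletion {
  completion_hausdorff : hausdorff_space E;
  completion_complete : forall F : set_system E,
    ProperFilter F -> tvs_cauchy F -> exists x : E, F --> x;
  completion_dense : dense (range iota);
  completion_embedding : forall A : set (symt V),
    sym_nbhs0 A <-> exists2 U : set E, nbhs (0 : E) U & iota @^-1` U `<=` A
}.

(* g is the extension by continuity of f along iota; it is unique, since
   range iota is dense and the target is Hausdorff *)
Definition extends1 (iota : symt V -> E) (f : symt V -> symt V) (g : E -> E) :=
  continuous g /\ forall X, g (iota X) = iota (f X).

Definition extends2 (iota : symt V -> E)
    (f : symt V -> symt V -> symt V) (g : E -> E -> E) :=
  continuous (fun p : E * E => g p.1 p.2) /\
  forall X Y, g (iota X) (iota Y) = iota (f X Y).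

Definition extends_form (iota : symt V -> E)
    (f : symt V -> symt V -> C) (g : E -> E -> C) :=
  continuous (fun p : E * E => g p.1 p.2 : C^o) /\
  forall X Y, g (iota X) (iota Y) = f X Y.

Definition form_norm (g : E -> E -> C) (x : E) : C := sqrtC (g x x).

Definition exp_term (mul : E -> E -> E) (one x : E) (n : nat) : E :=
  (n`!%:R)^-1 *: iter n (mul x) one.

(* The sum of the series, and 0 if it does not converge *)
Definition exp_prod (mul : E -> E -> E) (one x : E) : E :=
  xget 0 [set s | series (exp_term mul one x) @ \oo --> s].

End Completion.

Definition expC (C : numClosedFieldType) (z : C) : C :=
  limn (series (fun n => z ^+ n / n`!%:R : C^o)).

(* Main.v *)
From HB Require Import structures.
Require Import Defs.
From mathcomp Require Import all_boot all_order all_algebra complex.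
From mathcomp Require Import perm ring zify.
From mathcomp Require Import all_classical all_reals all_analysis.
Import Order.TTheory GRing.Theory Num.Theory numFieldNormedType.Exports.
Set Implicit Arguments.
Unset Strict Implicit.
Unset Printing Implicit Defensive.
Local Open Scope classical_set_scope.
Local Open Scope ring_scope.

(** Write v^[n] for the divided power v^{\vee n} / n! ([dpow]), so that
the exponential of v for the undeformed product is the sum of the v^[n].

The algebra is a computation with generating functions in a formal variable s.
Let * be the star product. Contracting t letters of v^k with t letters of w^l
gives
  v^[k] * w^[l] = \sum_t Lam(v, w)^t / t!  v^[k-t] w^[l-t]      ([star_dpow]),
and together with the binomial formula for (v + w)^[n] ([dpowD]) this reads
  exp(s v) * exp(s w) = exp(s^2 Lam(v, w)) exp(s (v + w)),
an identity between the coefficients of s^n ([star_dpow_antidiagonal]).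
Likewise the n-th term of the star exponential of v is the coefficient of s^n
in exp(s^2 Lam(v, v) / 2) exp(s v), a Hermite polynomial in v, because these
coefficients satisfy the recursion v * h_n = (n + 1) h_{n+1} ([star_hermite]).

Setting s = 1 is a matter of convergence. The square of the norm of v^[n] is
<v|v>^n / n!, which decays faster than every geometric sequence, and the same
is then true of every coefficient above. So all the series converge absolutely,
hence converge in the completion ([abs_cvg_iota]), and a double series may be
summed over squares or over antidiagonals ([cvg_square_antidiagonal]). Summing
over squares evaluates a continuous product at two limits; summing over
antidiagonals collects the powers of s.

The norm estimates need the triangle inequality for the extended form, hence
its positivity on all tensors ([tform_psd]). This is the Schur product theorem:
on finitely many vectors a positive form is a sum of terms conj(f(u)) f(v)
([gram_decomposition]), and the factors can be split off one letter at a
time. *)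

(** * Linear maps and the symmetric algebra *)

Section LinearMaps.
Context (K : fieldType) (U W : lmodType K) (g : U -> W).
Hypothesis gl : linear g.

Lemma linear_mapZ a x : g (a *: x) = a *: g x.
Proof. by rewrite -[a *: x]addr0 gl (linear_map0 gl) addr0. Qed.

Lemma linear_mapD x y : g (x + y) = g x + g y.
Proof. by rewrite -[x]scale1r gl !scale1r. Qed.

Lemma linear_map_sum (I : Type) (r : seq I) (P : pred I) (F : I -> U) :
  g (\sum_(i <- r | P i) F i) = \sum_(i <- r | P i) g (F i).
Proof. exact: (big_morph g linear_mapD (linear_map0 gl)). Qed.

End LinearMaps.

Section SymWords.
Context (K : fieldType) (V : lmodType K).
Implicit Types (s t : seq V) (v w : V).

(** Frees the type of the permutations from the expression for the length. *)
Lemma sym_wordE n s : size s = n ->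
  sym_word s = (n`!%:R)^-1 *: \sum_(p : 'S_n) tens [seq s`_(p i) | i <- enum 'I_n].
Proof. by move=> <-. Qed.

Lemma sym_word_perm s t : perm_eq s t -> sym_word s = sym_word t.
Proof.
move=> st; have sz := perm_size st.
have /tuple_permP[q sE] : perm_eq s (in_tuple t) by [].
rewrite (sym_wordE sz) (sym_wordE (erefl (size t))); congr (_ *: _).
rewrite [RHS](reindex_inj (mulIg q)); apply: eq_bigr => p _.
congr tens; apply: eq_map => i.
rewrite permM sE (nth_map (p i)) ?size_enum_ord //.
by rewrite nth_ord_enum (tnth_nth 0).
Qed.

Lemma symS_perm s t : perm_eq s t -> symS (tens s) = symS (tens t).
Proof. by move=> st; apply: val_inj; rewrite /= !SymE (sym_word_perm st). Qed.

Lemma symS_linear : linear (@symS K V).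
Proof. by move=> a X Y; apply: val_inj; rewrite /= linearP. Qed.
HB.instance Definition _ := GRing.isLinear.Build K _ _ _ (@symS K V) symS_linear.

Lemma tmul_linear_l (Y : talg V) : linear (fun X => tmul X Y).
Proof.
apply: tlift2_linear_l => u s1 s2 a x y; last by rewrite !catA tens_multilinear.
by rewrite -!catA !cat_cons tens_multilinear.
Qed.

Lemma tmul_linear_r (X : talg V) : linear (tmul X).
Proof.
apply: tlift2_linear_r => u s1 s2 a x y; last by rewrite !catA tens_multilinear.
by rewrite -!catA !cat_cons tens_multilinear.
Qed.

Lemma svee_linear_l (Y : symt V) : linear (fun X => svee X Y).
Proof. by move=> a X X'; rewrite /svee /= tmul_linear_l linearP. Qed.

Lemma svee_linear_r (X : symt V) : linear (svee X).
Proof. by move=> a Y Y'; rewrite /svee /= tmul_linear_r linearP. Qed.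

Lemma mu_vee_linear : linear (@mu_vee K V).
Proof.
apply: olift_linear => [Y a X X'|X a Y Y'].
  by rewrite tmul_linear_l linearP.
by rewrite tmul_linear_r linearP.
Qed.
HB.instance Definition _ := GRing.isLinear.Build K _ _ _ (@mu_vee K V) mu_vee_linear.

Lemma mu_veeE (X Y : talg V) : mu_vee (otimes X Y) = symS (tmul X Y).
Proof.
apply: oliftE => [Z a A B|Z a A B].
  by rewrite tmul_linear_l linearP.
by rewrite tmul_linear_r linearP.
Qed.

(** * The star product on words *)

Section Star.
Context (Lam : V -> V -> K).
Hypothesis Ll : forall w a u v, Lam (a *: u + v) w = a * Lam u w + Lam v w.
Hypothesis Lr : forall w a u v, Lam w (a *: u + v) = a * Lam w u + Lam w v.

Lemma P_Lambda_linear : linear (P_Lambda Lam).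
Proof.
have m1 := P_word_multilinear_l Ll; have m2 := P_word_multilinear_r Lr.
by apply: olift_linear => *; [apply: tlift2_linear_l|apply: tlift2_linear_r].
Qed.

Lemma iterP_linear n : linear (iter n (P_Lambda Lam)).
Proof. by elim: n => [//|n IH] a X Y; rewrite !iterS IH P_Lambda_linear. Qed.

Lemma iterP_otimes_linear_l n (Y : talg V) :
  linear (fun X => iter n (P_Lambda Lam) (otimes X Y)).
Proof. by move=> a X X'; rewrite otimesDl iterP_linear. Qed.

Lemma iterP_otimes_linear_r n (X : talg V) :
  linear (fun Y => iter n (P_Lambda Lam) (otimes X Y)).
Proof. by move=> a Y Y'; rewrite otimesDr iterP_linear. Qed.

Lemma iterP0 n : iter n (P_Lambda Lam) 0 = 0.
Proof. exact: linear_map0 (iterP_linear n). Qed.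

Lemma iterP_words s t n : (size s < n)%N ->
  iter n (P_Lambda Lam) (otimes (tens s) (tens t)) = 0.
Proof.
elim: n s t => [//|n IH] s t; rewrite ltnS iterSr P_LambdaE // => ltn.
case/lastP: s ltn => [_|s x]; first by rewrite /= iterP0.
case: t => [|y t]; first by rewrite P_word_nilr iterP0.
rewrite size_rcons P_word_rcons => ltn.
by rewrite (linear_mapZ (iterP_linear _)) IH ?scaler0.
Qed.

(** Each contraction removes a letter from both factors, so the series that
defines the star product is a finite sum; this is what makes it bilinear. *)
Lemma iterP_nilpotent (X Y : talg V) :
  exists N, forall n, (N <= n)%N -> iter n (P_Lambda Lam) (otimes X Y) = 0.
Proof.
elim/talg_ind: X => [|c s X [N HN]].
  by exists 0%N => n _; exact: (linear_map0 (iterP_otimes_linear_l n Y)).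
exists (maxn (size s).+1 N) => n; rewrite geq_max => /andP[sn Nn].
rewrite iterP_otimes_linear_l HN // addr0.
elim/talg_ind: Y {HN} => [|d t Y IH].
  by rewrite (linear_map0 (iterP_otimes_linear_r n _)) scaler0.
by rewrite iterP_otimes_linear_r iterP_words // scaler0 add0r.
Qed.

Definition star_term (X Y : symt V) (t : nat) : symt V :=
  (t`!%:R)^-1 *: mu_vee (iter t (P_Lambda Lam) (otimes (\val X) (\val Y))).

Lemma star_sum (X Y : symt V) N : (forall n, (N <= n)%N -> star_term X Y n = 0) ->
  star Lam X Y = \sum_(t < N) star_term X Y t.
Proof.
move=> X0; rewrite fsbig_ord; symmetry.
apply: (@fsbig_widen _ _ _ _ `I_N setT (star_term X Y)) => // t [_ /= /negP].
by rewrite -leqNgt; exact: X0.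
Qed.

Lemma star_linear_l (Y : symt V) : linear (fun X => star Lam X Y).
Proof.
move=> a X X'.
have [N1 H1] := iterP_nilpotent (\val X) (\val Y).
have [N2 H2] := iterP_nilpotent (\val X') (\val Y).
have H3 (t : nat) : star_term (a *: X + X') Y t = a *: star_term X Y t + star_term X' Y t.
  rewrite /star_term [\val _]/= iterP_otimes_linear_l linearP /= scalerDr.
  by rewrite !scalerA mulrC.
have z1 (t : nat) : (N1 + N2 <= t)%N -> star_term X Y t = 0.
  by move=> Nt; rewrite /star_term H1 ?linear0 ?scaler0 // (leq_trans _ Nt) ?leq_addr.
have z2 (t : nat) : (N1 + N2 <= t)%N -> star_term X' Y t = 0.
  by move=> Nt; rewrite /star_term H2 ?linear0 ?scaler0 // (leq_trans _ Nt) ?leq_addl.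
rewrite !(@star_sum _ _ (N1 + N2)) //; last first.
  by move=> t Nt; rewrite H3 z1 // z2 // scaler0 addr0.
by rewrite scaler_sumr -big_split; apply: eq_bigr => t _; exact: H3.
Qed.

Lemma star_linear_r (X : symt V) : linear (star Lam X).
Proof.
move=> a Y Y'.
have [N1 H1] := iterP_nilpotent (\val X) (\val Y).
have [N2 H2] := iterP_nilpotent (\val X) (\val Y').
have H3 (t : nat) : star_term X (a *: Y + Y') t = a *: star_term X Y t + star_term X Y' t.
  rewrite /star_term [\val _]/= iterP_otimes_linear_r linearP /= scalerDr.
  by rewrite !scalerA mulrC.
have z1 (t : nat) : (N1 + N2 <= t)%N -> star_term X Y t = 0.
  by move=> Nt; rewrite /star_term H1 ?linear0 ?scaler0 // (leq_trans _ Nt) ?leq_addr.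
have z2 (t : nat) : (N1 + N2 <= t)%N -> star_term X Y' t = 0.
  by move=> Nt; rewrite /star_term H2 ?linear0 ?scaler0 // (leq_trans _ Nt) ?leq_addl.
rewrite !(@star_sum _ _ (N1 + N2)) //; last first.
  by move=> t Nt; rewrite H3 z1 // z2 // scaler0 addr0.
by rewrite scaler_sumr -big_split; apply: eq_bigr => t _; exact: H3.
Qed.

(** The falling factorials vanish once t exceeds k or l, so the truncated
subtractions do no harm. *)
Lemma iterP_nseq v w (k l t : nat) :
  iter t (P_Lambda Lam) (otimes (tens (nseq k v)) (tens (nseq l w))) =
  ((k ^_ t * l ^_ t)%:R * Lam v w ^+ t) *:
    otimes (tens (nseq (k - t) v)) (tens (nseq (l - t) w)).
Proof.
elim: t => [|t IH]; first by rewrite /= !ffactn0 !subn0 mul1r scale1r.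
rewrite iterS {}IH (linear_mapZ P_Lambda_linear) P_LambdaE // !ffactnSr !subnS.
case: (k - t)%N => [|k']; first by rewrite muln0 mul0n /= !scaler0 mul0r scale0r.
case: (l - t)%N => [|l']; first by rewrite P_word_nilr !muln0 scaler0 mul0r scale0r.
have -> : nseq k'.+1 v = rcons (nseq k' v) v by elim: k' => //= n ->.
rewrite P_word_rcons !size_nseq scalerA exprSr /= !natrM; congr (_ *: _).
ring.
Qed.

End Star.
End SymWords.

Lemma fact_neq0 (K : numFieldType) n : n`!%:R != 0 :> K.
Proof. by rewrite pnatr_eq0 -lt0n fact_gt0. Qed.

(** * Divided powers of a vector *)

Section DividedPowers.
Context (K : numFieldType) (V : lmodType K).
Implicit Types (v w : V).

Definition dpow v n : symt V := (n`!%:R)^-1 *: symS (tens (nseq n v)).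

Lemma dpow0 v : dpow v 0 = sone V.
Proof. by rewrite /dpow fact0 invr1 scale1r. Qed.

Lemma svecE v : svec v = dpow v 1.
Proof. by rewrite /dpow invr1 scale1r. Qed.

Lemma symval_nseq v n : \val (symS (tens (nseq n v))) = tens (nseq n v).
Proof.
rewrite /= SymE (@sym_wordE _ _ n) ?size_nseq //.
rewrite (eq_bigr (fun=> tens (nseq n v))) => [|p _].
  rewrite sumr_const card_Sn -scalerMnr scalerMnl -mulr_natr.
  by rewrite mulVf ?scale1r // fact_neq0.
congr tens; rewrite (eq_map (g := fun=> v)) => [|i]; last by rewrite nth_nseq ltn_ord.
apply: (@eq_from_nth _ 0) => [|i]; first by rewrite size_map size_nseq size_enum_ord.
rewrite size_map size_enum_ord => lt.
by rewrite (nth_map (Ordinal lt)) ?size_enum_ord // nth_nseq lt.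
Qed.

Lemma val_dpow v n : \val (dpow v n) = (n`!%:R)^-1 *: tens (nseq n v).
Proof. by rewrite -symval_nseq. Qed.

Lemma svee_dpow v w i j : svee (dpow v i) (dpow w j) =
  (i`!%:R * j`!%:R)^-1 *: symS (tens (nseq i v ++ nseq j w)).
Proof.
rewrite /dpow (linear_mapZ (svee_linear_l _)) (linear_mapZ (svee_linear_r _)).
by rewrite scalerA -invfM /svee !symval_nseq tmulE.
Qed.

Lemma svee_svec_dpow v n : svee (svec v) (dpow v n) = n.+1%:R *: dpow v n.+1.
Proof.
rewrite svecE svee_dpow (_ : 1`!%:R = 1) // mul1r /dpow scalerA factS natrM.
by rewrite invfM mulrA divff ?mul1r // pnatr_eq0.
Qed.

Lemma iter_svee v n : iter n (svee (svec v)) (sone V) = n`!%:R *: dpow v n.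
Proof.
elim: n => [|n IH]; first by rewrite dpow0 scale1r.
rewrite iterS IH (linear_mapZ (svee_linear_r _)).
by rewrite svee_svec_dpow scalerA factS mulnC natrM.
Qed.

(** The binomial formula. Pascal's rule is applied in the presence of a spectator
word u, which absorbs the letters that have already been expanded. *)
Lemma dpowD v w n :
  dpow (v + w) n = \sum_(i < n.+1) svee (dpow v i) (dpow w (n - i)).
Proof.
have H (u : seq V) : symS (tens (nseq n (v + w) ++ u)) =
    \sum_(i < n.+1) 'C(n, i)%:R *: symS (tens (nseq i v ++ nseq (n - i) w ++ u)).
  elim: n u => [|n IH] u; first by rewrite big_ord1 scale1r.
  have -> : symS (tens (nseq n.+1 (v + w) ++ u)) =
      symS (tens (nseq n (v + w) ++ v :: u)) + symS (tens (nseq n (v + w) ++ w :: u)).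
    rewrite (@symS_perm _ _ _ (nseq n (v + w) ++ (v + w) :: u)).
      by rewrite -[v]scale1r tens_multilinear linearP /= !scale1r.
    by rewrite perm_sym -(cat1s _ u) perm_catCA.
  pose T i := symS (tens (nseq i v ++ nseq (n.+1 - i) w ++ u)).
  have TS (i : 'I_n.+1) : symS (tens (nseq i v ++ nseq (n - i) w ++ v :: u)) = T i.+1.
    by apply: symS_perm; rewrite -(cat1s v u) catA perm_catCA -catA subSS.
  have T1 (i : 'I_n.+1) : symS (tens (nseq i v ++ nseq (n - i) w ++ w :: u)) = T i.
    apply: symS_perm; rewrite perm_cat2l -(cat1s w u) perm_catCA subSn //.
    by rewrite -ltnS.
  rewrite !IH (eq_bigr (fun i : 'I_n.+1 => 'C(n, i)%:R *: T i.+1)); last first.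
    by move=> i _; rewrite TS.
  rewrite [X in _ + X](eq_bigr (fun i : 'I_n.+1 => 'C(n, i)%:R *: T i)); last first.
    by move=> i _; rewrite T1.
  rewrite [RHS]big_ord_recl.
  rewrite [X in _ + X = _](_ : _ = \sum_(i < n.+2) 'C(n, i)%:R *: T i); last first.
    by rewrite [RHS]big_ord_recr /= bin_small // scale0r addr0.
  rewrite [X in _ + X = _]big_ord_recl !bin0 addrCA; congr (_ + _).
  rewrite -big_split; apply: eq_bigr => i _ /=.
  by rewrite binS natrD scalerDl addrC.
rewrite /dpow -[nseq n (v + w)]cats0 H scaler_sumr; apply: eq_bigr => i _.
have lein : (i <= n)%N by rewrite -ltnS.
rewrite svee_dpow cats0 scalerA; congr (_ *: _).
rewrite -(bin_fact lein) !natrM; field.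
by rewrite !fact_neq0 pnatr_eq0 -lt0n bin_gt0.
Qed.

Section Star.
Context (Lam : V -> V -> K).
Hypothesis Ll : forall w a u v, Lam (a *: u + v) w = a * Lam u w + Lam v w.
Hypothesis Lr : forall w a u v, Lam w (a *: u + v) = a * Lam w u + Lam w v.

Lemma star_term_dpow v w k l t : star_term Lam (dpow v k) (dpow w l) t =
  if (t <= k)%N && (t <= l)%N
  then (Lam v w ^+ t / t`!%:R) *: svee (dpow v (k - t)) (dpow w (l - t)) else 0.
Proof.
rewrite /star_term !val_dpow (linear_mapZ (iterP_otimes_linear_l Ll Lr _ _)).
rewrite (linear_mapZ (iterP_otimes_linear_r Ll Lr _ _)).
rewrite (iterP_nseq Ll Lr) !linearZ /= mu_veeE tmulE svee_dpow !scalerA.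
case: ifPn => [/andP[tk tl]|]; last first.
  rewrite negb_and -!ltnNge => /orP[] /ffact_small ->.
    by rewrite mul0n mulr0n mul0r !(mul0r, mulr0) scale0r.
  by rewrite muln0 mulr0n mul0r !(mul0r, mulr0) scale0r.
congr (_ *: _); rewrite -(ffact_fact tk) -(ffact_fact tl) !natrM; field.
by rewrite !fact_neq0 !pnatr_eq0 -!lt0n !ffact_gt0 tk tl.
Qed.

Lemma star_dpow v w k l N : (minn k l < N)%N ->
  star Lam (dpow v k) (dpow w l) = \sum_(t < N) if (t <= k)%N && (t <= l)%N
  then (Lam v w ^+ t / t`!%:R) *: svee (dpow v (k - t)) (dpow w (l - t)) else 0.
Proof.
move=> klN; rewrite (@star_sum _ _ _ _ _ N) => [|t Nt].
  by apply: eq_bigr => t _; exact: star_term_dpow.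
by rewrite star_term_dpow -leq_min leqNgt (leq_trans klN Nt).
Qed.

End Star.
End DividedPowers.

Lemma big_ord_even (W : nmodType) (F : nat -> W) n :
  \sum_(i < n.+1) (if odd i then 0 else F i) = \sum_(t < n./2.+1) F t.*2.
Proof.
elim: n => [|n IH]; first by rewrite !big_ord1.
rewrite big_ord_recr IH /= uphalf_half; case: (boolP (odd n)) => [on|en] /=.
  by rewrite [RHS]big_ord_recr /=; congr (_ + F _); lia.
by rewrite addr0.
Qed.

(** * Generating functions *)

(** The coefficient of s^i in exp(z s^2). *)
Definition gauss_coef (K : numFieldType) (z : K) i : K :=
  if odd i then 0 else z ^+ i./2 / (i./2)`!%:R.

(** The differential equation g' = z s g of g = exp(z s^2 / 2). *)
Lemma gauss_coef_rec (K : numFieldType) (z : K) i :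
  i.+2%:R * gauss_coef (z / 2) i.+2 = z * gauss_coef (z / 2) i.
Proof.
rewrite /gauss_coef /= negbK; case: (boolP (odd i)) => oi; first by rewrite !mulr0.
have -> : i.+2 = (2 * i./2.+1)%N by lia.
rewrite factS !natrM exprS; field.
by rewrite fact_neq0 ?natr1 ?nat1r pnatr_eq0.
Qed.

Section Generating.
Context (K : numFieldType) (V : lmodType K) (Lam : V -> V -> K).
Implicit Types (v w : V).
Hypothesis Ll : forall w a u v, Lam (a *: u + v) w = a * Lam u w + Lam v w.
Hypothesis Lr : forall w a u v, Lam w (a *: u + v) = a * Lam w u + Lam w v.

(** The coefficient of s^n in exp(s v) * exp(s w) = exp(s^2 Lam(v, w)) exp(s (v + w)). *)
Lemma star_dpow_antidiagonal v w n :
  \sum_(k < n.+1) star Lam (dpow v k) (dpow w (n - k)) =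
  \sum_(i < n.+1) gauss_coef (Lam v w) i *: dpow (v + w) (n - i).
Proof.
have mh k : (minn k (n - k) < n./2.+1)%N by lia.
under eq_bigr => k _ do rewrite (star_dpow Ll Lr _ _ (mh k)).
rewrite exchange_big /=.
under [RHS]eq_bigr => i _.
  rewrite (_ : _ *: _ = if odd i then 0 else
    (Lam v w ^+ i./2 / (i./2)`!%:R) *: dpow (v + w) (n - i)); last first.
    by rewrite /gauss_coef; case: ifP; rewrite ?scale0r.
  over.
rewrite (big_ord_even (fun i => (Lam v w ^+ i./2 / (i./2)`!%:R) *: dpow (v + w) (n - i))).
apply: eq_bigr => t _ /=; rewrite doubleK dpowD scaler_sumr.
(* Only the n + 1 - 2t indices k with t <= k <= n - t contribute. *)
pose m := (n - t.*2)%N.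
pose G k := if (t <= k)%N && (t <= n - k)%N then
  (Lam v w ^+ t / t`!%:R) *: svee (dpow v (k - t)) (dpow w (n - k - t)) else 0.
have tn : (t < n./2.+1)%N by [].
have en : n.+1 = (t + (m.+1 + t))%N by rewrite /m; lia.
rewrite -(big_mkord xpredT G) en big_mkord big_split_ord /= big1 ?add0r => [|i _];
  last first.
  by rewrite /G /= leqNgt ltn_ord.
rewrite big_split_ord /= [X in _ + X]big1 ?addr0 => [|i _]; last first.
  by rewrite /G; case: ifP => // /andP[_]; move: (ltn_ord i) => /=; lia.
apply: eq_bigr => i _; rewrite /G /=.
move: (ltn_ord i); rewrite ltnS => im.
rewrite ifT; last by rewrite /m in im *; lia.
by congr (_ *: svee (dpow v _) (dpow w _)); rewrite /m in im *; lia.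
Qed.

Lemma svee1 v n : svee (sone V) (dpow v n) = dpow v n.
Proof. by rewrite -(dpow0 v) svee_dpow fact0 mul1r. Qed.

Lemma star_svec_dpow v m : star Lam (svec v) (dpow v m) =
  m.+1%:R *: dpow v m.+1 + (if m is m'.+1 then Lam v v *: dpow v m' else 0).
Proof.
rewrite {1}svecE (@star_dpow _ _ _ Ll Lr _ _ _ _ 2); last by lia.
rewrite big_ord_recl big_ord1 /= -svecE subn0 expr0 fact0 divr1 scale1r.
rewrite svee_svec_dpow; congr (_ + _).
case: m => [//|m]; rewrite (_ : bump 0 0 = 1%N) //= !subn1 /= dpow0 svee1.
by rewrite expr1 (_ : 1`!%:R = 1) // divr1.
Qed.

(** The coefficient of s^n in exp(s^2 Lam(v, v) / 2) exp(s v). *)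
Definition hermite v n : symt V :=
  \sum_(i < n.+1) gauss_coef (Lam v v / 2) i *: dpow v (n - i).

(** Multiplying by v differentiates the generating function in s: each v^[m]
contributes (m + 1) v^[m+1] from the product rule and Lam(v, v) v^[m-1] from the
contraction, and the latter is the derivative of the Gaussian factor. *)
Lemma star_hermite v n :
  star Lam (svec v) (hermite v n) = n.+1%:R *: hermite v n.+1.
Proof.
pose g := gauss_coef (Lam v v / 2).
have slin := star_linear_r Ll Lr (svec v).
rewrite (linear_map_sum slin).
under eq_bigr => i _ do rewrite (linear_mapZ slin) star_svec_dpow scalerDr.
rewrite big_split /= scaler_sumr.
(* n + 1 = (n + 1 - j) + j *)
have -> : \sum_(j < n.+2) n.+1%:R *: (g j *: dpow v (n.+1 - j)) =
    \sum_(j < n.+2) (n.+1 - j)%:R *: (g j *: dpow v (n.+1 - j)) +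
    \sum_(j < n.+2) j%:R *: (g j *: dpow v (n.+1 - j)).
  rewrite -big_split; apply: eq_bigr => j _ /=.
  by rewrite -scalerDl -natrD subnK // -ltnS.
congr (_ + _).
  rewrite [RHS]big_ord_recr /= subnn scale0r addr0; apply: eq_bigr => i _.
  have lein : (i <= n)%N by rewrite -ltnS.
  by rewrite subSn // !(scalerA _ _ (dpow _ _)) mulrC.
rewrite big_ord_recr /= subnn scaler0 addr0.
rewrite [RHS]big_ord_recl /= scale0r add0r [RHS]big_ord_recl /=.
rewrite [g _]/g /gauss_coef /= scale0r scaler0 add0r; apply: eq_bigr => i _.
have lin : (i < n)%N by [].
rewrite -(subnSK lin) /= /bump /= !add1n !(scalerA _ _ (dpow _ _)) gauss_coef_rec mulrC.
by rewrite subSS.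
Qed.

Lemma iter_star v n : iter n (star Lam (svec v)) (sone V) = n`!%:R *: hermite v n.
Proof.
elim: n => [|n IH].
  by rewrite /hermite big_ord1 /gauss_coef /= expr0 fact0 divr1 !scale1r dpow0.
rewrite iterS IH (linear_mapZ (star_linear_r Ll Lr _)) star_hermite.
by rewrite scalerA factS mulnC natrM.
Qed.

End Generating.

(** * Positive Hermitian forms *)

Section Sesquilinear.
Context (C : numClosedFieldType) (W : lmodType C) (h : W -> W -> C).
Hypothesis hl : forall w a u v, h (a *: u + v) w = a^* * h u w + h v w.
Hypothesis hr : forall u a v w, h u (a *: v + w) = a * h u v + h u w.

Lemma form0l w : h 0 w = 0.
Proof. by have := hl w (-1) 0 0; rewrite scaler0 addr0 rmorphN1 mulN1r addNr. Qed.

Lemma form0r w : h w 0 = 0.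
Proof. by have := hr w (-1) 0 0; rewrite scaler0 addr0 mulN1r addNr. Qed.

Lemma formZl a u w : h (a *: u) w = a^* * h u w.
Proof. by rewrite -[a *: u]addr0 hl form0l addr0. Qed.

Lemma formZr a u w : h w (a *: u) = a * h w u.
Proof. by rewrite -[a *: u]addr0 hr form0r addr0. Qed.

Lemma formDl w : {morph h ^~ w : u v / u + v}.
Proof. by move=> u v; rewrite -[u]scale1r hl rmorph1 mul1r scale1r. Qed.

Lemma formDr w : {morph h w : u v / u + v}.
Proof. by move=> u v; rewrite -[u]scale1r hr mul1r scale1r. Qed.

Lemma form_suml (I : Type) (r : seq I) (F : I -> W) w :
  h (\sum_(i <- r) F i) w = \sum_(i <- r) h (F i) w.
Proof. exact: (big_morph (h ^~ w) (formDl w) (form0l w)). Qed.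

Lemma form_sumr (I : Type) (r : seq I) (F : I -> W) w :
  h w (\sum_(i <- r) F i) = \sum_(i <- r) h w (F i).
Proof. exact: (big_morph (h w) (formDr w) (form0r w)). Qed.

End Sesquilinear.

Section PositiveForms.
Context (C : numClosedFieldType) (W : lmodType C).
Implicit Types (h : W -> W -> C) (u v w : W).

Definition psd_form h := [/\
  forall w a u v, h (a *: u + v) w = a^* * h u w + h v w,
  forall u a v w, h u (a *: v + w) = a * h u v + h u w,
  forall u v, h u v = (h v u)^* &
  forall v, 0 <= h v v].

Section CauchySchwarz.
Context (h : W -> W -> C) (hP : psd_form h).

Lemma psd_comb (a b : C) u v : h (a *: u + b *: v) (a *: u + b *: v) =
  a^* * a * h u u + a^* * b * h u v + b^* * a * h v u + b^* * b * h v v.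
Proof.
case: hP => hl hr _ _.
by rewrite hl (formZl hl) !hr !(formZr hr); ring.
Qed.

(** The form may be degenerate, so the usual argument, which divides by h u u or
h v v, has to be completed by the case in which both vanish. *)
Lemma psd_CauchySchwarz u v : `|h u v| ^+ 2 <= h u u * h v v.
Proof.
case: (hP) => _ _ hh h0.
have key x y : 0 < h x x -> `|h x y| ^+ 2 <= h x x * h y y.
  move=> xx; have := h0 (h x x *: y + (- h x y) *: x); rewrite psd_comb.
  have -> : (h x x)^* = h x x by rewrite -hh.
  rewrite rmorphN /= -(hh y x) => H.
  rewrite normCK -(hh y x) -subr_ge0 -(pmulr_rge0 _ xx).
  apply: le_trans H _; rewrite le_eqVlt; apply/orP; left; apply/eqP; ring.
have := h0 u; rewrite le_eqVlt => /predU1P[u0|/key//].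
have := h0 v; rewrite le_eqVlt => /predU1P[v0|/key H]; last first.
  by rewrite hh norm_conjC mulrC.
have := h0 (1 *: u + (- h v u) *: v).
rewrite psd_comb -u0 -v0 (hh v u) rmorphN /= conjCK rmorph1 => H.
have {H} : 0 <= - (h u v * (h u v)^* *+ 2).
  by apply: le_trans H _; rewrite le_eqVlt; apply/orP; left; apply/eqP; ring.
by rewrite oppr_ge0 pmulrn_lle0 // -normCK mul0r.
Qed.

Lemma psd_eq0 u v : h u u = 0 -> h u v = 0.
Proof.
move=> u0; have := psd_CauchySchwarz u v; rewrite u0 mul0r => H.
have : `|h u v| ^+ 2 == 0 by rewrite eq_le H exprn_ge0.
by rewrite expf_eq0 /= normr_eq0 => /eqP.
Qed.

Lemma psd_triangle u v :
  sqrtC (h (u + v) (u + v)) <= sqrtC (h u u) + sqrtC (h v v).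
Proof.
case: (hP) => _ _ hh h0.
rewrite -(@ler_pXn2r _ 2) ?nnegrE ?addr_ge0 ?sqrtC_ge0 // sqrtCK sqrrD !sqrtCK.
rewrite -[u]scale1r -[v]scale1r psd_comb rmorph1 !mul1r !scale1r.
rewrite lerD2r -addrA lerD2l.
have -> : h u v + h v u = 'Re (h u v) *+ 2.
  by rewrite ReE -(hh v u) -mulr_natr divfK ?pnatr_eq0.
rewrite lerMn2r /= (le_trans (leif_Re_Creal (h u v))) //.
rewrite -(@ler_pXn2r _ 2) ?nnegrE ?mulr_ge0 ?sqrtC_ge0 //.
by rewrite exprMn !sqrtCK psd_CauchySchwarz.
Qed.

Lemma psd_sqrtZ (a : C) v :
  sqrtC (h (a *: v) (a *: v)) = `|a| * sqrtC (h v v).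
Proof.
case: (hP) => hl hr _ h0.
rewrite (formZl hl) (formZr hr) mulrA [a^* * a]mulrC -normCK.
by rewrite sqrtCM ?nnegrE ?exprn_ge0 // exprCK.
Qed.

End CauchySchwarz.

(** Gram-Schmidt: each vector x of the list contributes the functional
h(x, .) / |x|, after which h is replaced by its part orthogonal to x. The bound
on the functionals makes those found later vanish at x. Since the inverse
of 0 is 0, a vector of length 0 contributes the functional 0 and leaves h as it
is, as it should. *)
Lemma gram_decomposition h (xs : seq W) : psd_form h ->
  exists n (F : nat -> W -> C), (forall i v, `|F i v| ^+ 2 <= h v v) /\
    {in xs &, forall u v, h u v = \sum_(i < n) (F i u)^* * F i v}.
Proof.
elim: xs h => [|x xs IH] h hP.
  exists 0%N, (fun _ _ => 0); split=> // i v.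
  by rewrite normr0 expr0n; case: hP.
have [hl hr hh h0] := hP.
have xr : (h x x)^* = h x x by rewrite -hh.
pose h' u v := h u v - h u x * h x v / h x x.
have h'P : psd_form h'.
  split=> [w a u v|u a v w|u v|v]; rewrite /h'.
  - by rewrite !hl; ring.
  - by rewrite !hr; ring.
  - rewrite rmorphB !rmorphM /= fmorphV /= xr -(hh u v) -(hh u x) -(hh x v).
    by rewrite [h x v * _]mulrC.
  rewrite (hh v x) [_ * h x v]mulrC -normCK subr_ge0.
  have := h0 x; rewrite le_eqVlt => /predU1P[<-|xx]; first by rewrite invr0 mulr0.
  by rewrite ler_pdivrMr // mulrC psd_CauchySchwarz.
have h'x : h' x x = 0.
  rewrite /h'; have [->|xx] := eqVneq (h x x) 0; first by rewrite mul0r mul0r subrr.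
  by rewrite mulfK // subrr.
have h'le v : h' v v <= h v v.
  rewrite /h' (hh v x) [_ * h x v]mulrC -normCK lerBlDr lerDl.
  by rewrite divr_ge0 ?exprn_ge0.
have [n [F [Fle FE]]] := IH _ h'P.
have Fx i : F i x = 0.
  apply/eqP; rewrite -normr_eq0 -sqrf_eq0 eq_le exprn_ge0 // andbT.
  by rewrite -h'x Fle.
exists n.+1, (fun i => if i is i'.+1 then F i' else fun v => h x v / sqrtC (h x x)).
split=> [[|i] v|u v ux vx]; last 1 first.
- rewrite big_ord_recl /=.
  have -> : \sum_(i < n) (F i u)^* * F i v = h' u v.
    have Z : \sum_(i < n) (F i u)^* * F i v =
      if (u \in xs) && (v \in xs) then h' u v else 0.
      case: ifPn => [/andP[? ?]|]; first by rewrite -FE.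
      rewrite negb_and => nuv; rewrite big1 // => i _.
      move: ux vx nuv; rewrite !inE.
      by move=> /orP[/eqP->|->] /orP[/eqP->|->]; rewrite // !Fx ?rmorph0 ?mul0r ?mulr0.
    rewrite Z; case: ifPn => //; rewrite negb_and => nuv.
    have h'xv w : h' x w = 0 by apply: psd_eq0.
    have h'vx w : h' w x = 0 by case: h'P => _ _ -> _; rewrite h'xv rmorph0.
    move: ux vx nuv; rewrite !inE.
    by move=> /orP[/eqP->|->] /orP[/eqP->|->]; rewrite // ?h'xv ?h'vx.
  have sr : (sqrtC (h x x))^* = sqrtC (h x x).
    by apply: conj_Creal; rewrite ger0_real // sqrtC_ge0.
  rewrite rmorphM /= fmorphV /= sr -(hh u x) mulf_div -expr2 sqrtCK /h'.
  by rewrite addrC subrK.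
- rewrite normrM exprMn normfV exprVn [`|sqrtC _|]ger0_norm ?sqrtC_ge0 // sqrtCK.
  have := h0 x; rewrite le_eqVlt => /predU1P[<-|xx]; first by rewrite invr0 mulr0.
  by rewrite ler_pdivrMr // mulrC psd_CauchySchwarz.
- exact: le_trans (Fle i v) (h'le v).
Qed.

End PositiveForms.

(** * Positivity and norms on tensors *)

Section TensorForm.
Context (C : numClosedFieldType) (V : tvsType C) (al : hform V).
Implicit Types (s t : seq V) (X Y : talg V).

Lemma hform_psd : psd_form al.
Proof.
split; [exact: hform_antilinear|exact: hform_linear|exact: hform_hermitian|].
exact: hform_ge0.
Qed.

(** The form on words without the factor k!, which would spoil the recursion on
the letters. *)
Definition word_kernel s t : C :=
  if size s == size t then \prod_(xy <- zip s t) al xy.1 xy.2 else 0.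

Lemma word_kernel_rec s t : word_kernel s t =
  (nilp s)%:R * (nilp t)%:R +
  (~~ nilp s)%:R * (~~ nilp t)%:R * al (head 0 s) (head 0 t) *
    word_kernel (behead s) (behead t).
Proof.
case: s t => [|x s] [|y t]; rewrite /word_kernel /= ?eqSS;
  rewrite ?(mul0r, mulr0, mul1r, mulr1, add0r, addr0) ?big_nil //.
by case: ifP => _; rewrite ?big_cons ?mulr0.
Qed.

(** Schur product theorem, by induction on the length: a decomposition of al on
the first letters writes the sum as a sum over r of sums of the same shape for
the words without their first letter, with coefficients d r. *)
Lemma word_kernel_ge0 n (I : finType) (c : I -> C) (s : I -> seq V) :
  (forall i, size (s i) <= n)%N ->
  0 <= \sum_i \sum_j (c i)^* * c j * word_kernel (s i) (s j).
Proof.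
have sq_ge0 (d : I -> C) : 0 <= \sum_i \sum_j (d i)^* * d j.
  have -> : \sum_i \sum_j (d i)^* * d j = `|\sum_i d i| ^+ 2.
    rewrite normCK mulrC rmorph_sum /= mulr_suml; apply: eq_bigr => i _.
    by rewrite mulr_sumr.
  exact: exprn_ge0.
elim: n c s => [|n IH] c s sn.
  have -> : \sum_i \sum_j (c i)^* * c j * word_kernel (s i) (s j) =
      \sum_i \sum_j (c i)^* * c j.
    apply: eq_bigr => i _; apply: eq_bigr => j _.
    have s0 k : s k = [::] by apply: size0nil; apply/eqP; rewrite -leqn0.
    by rewrite !s0 /word_kernel /= big_nil mulr1.
  exact: sq_ge0.
pose hd i : V := head 0 (s i).
have [N [F [_ FE]]] := gram_decomposition (map hd (enum I)) hform_psd.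
have hin i : hd i \in map hd (enum I) by rewrite map_f ?mem_enum.
pose d r i := c i * (~~ nilp (s i))%:R * F r (head 0 (s i)).
have -> : \sum_i \sum_j (c i)^* * c j * word_kernel (s i) (s j) =
    \sum_i \sum_j (c i * (nilp (s i))%:R)^* * (c j * (nilp (s j))%:R) +
    \sum_(r < N) \sum_i \sum_j
      (d r i)^* * d r j * word_kernel (behead (s i)) (behead (s j)).
  rewrite [X in _ = _ + X]exchange_big -big_split; apply: eq_bigr => i _ /=.
  rewrite [X in _ = _ + X]exchange_big -big_split; apply: eq_bigr => j _ /=.
  rewrite word_kernel_rec (FE _ _ (hin i) (hin j)).
  rewrite mulrDr; congr (_ + _).
    by rewrite rmorphM rmorph_nat; ring.
  rewrite mulr_sumr mulr_suml mulr_sumr; apply: eq_bigr => r _.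
  by rewrite /d !rmorphM !rmorph_nat; ring.
rewrite addr_ge0 ?sq_ge0 // sumr_ge0 // => r _; apply: IH => i.
by rewrite size_behead -subn1 leq_subLR add1n.
Qed.

(** k! is split into two factors sqrt(k!), each depending on one word only, which
a linear combination of words can absorb in its coefficients. *)
Lemma form_wordE s t : form_word al s t =
  (sqrtC (size s)`!%:R)^* * sqrtC (size t)`!%:R * word_kernel s t.
Proof.
rewrite /form_word /word_kernel; case: eqP => [->|_]; last by rewrite mulr0.
have -> : (sqrtC (size t)`!%:R)^* = sqrtC (size t)`!%:R :> C.
  by apply: conj_Creal; rewrite ger0_real // sqrtC_ge0 ler0n.
by rewrite -expr2 sqrtCK.
Qed.

Lemma tform_psd : psd_form (tform al).
Proof.
have antil w a u v := tform_antilinear al a u v w; have lin := tform_linear al.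
split=> [w a u v|u a v w|X Y|X]; first exact: antil.
- exact: lin.
- elim/talg_ind: X => [|c s X IH].
    by rewrite (form0l antil) (form0r lin) rmorph0.
  rewrite antil lin IH rmorphD rmorphM /=; congr (_ * _ + _).
  elim/talg_ind: Y {IH X} => [|d t Y IH].
    by rewrite (form0l antil) (form0r lin) rmorph0.
  by rewrite antil lin IH rmorphD rmorphM /= conjCK !tformE -form_wordC.
have [l ->] := presmod_spanP X.
rewrite (big_nth (0, [::])) big_mkord.
pose c (i : 'I_(size l)) := (nth (0, [::]) l i).1.
pose s (i : 'I_(size l)) := (nth (0, [::]) l i).2.
rewrite [X in 0 <= X](_ : _ = \sum_i \sum_j (c i * sqrtC (size (s i))`!%:R)^* *
    (c j * sqrtC (size (s j))`!%:R) * word_kernel (s i) (s j)).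
  apply: (@word_kernel_ge0 (\max_i size (s i))) => i.
  exact: (leq_bigmax i).
rewrite (form_suml antil); apply: eq_bigr => i _.
rewrite (form_sumr lin); apply: eq_bigr => j _.
by rewrite (formZl antil) (formZr lin) tformE form_wordE /c /s rmorphM; ring.
Qed.

Lemma symform_psd : psd_form (symform al).
Proof.
have [hl hr hh h0] := tform_psd.
by split=> *; [exact: hl|exact: hr|exact: hh|exact: h0].
Qed.

Lemma symnorm_ge0 Z : 0 <= symnorm al Z.
Proof. by rewrite sqrtC_ge0; case: symform_psd. Qed.

Lemma symnormD Z Z' : symnorm al (Z + Z') <= symnorm al Z + symnorm al Z'.
Proof. exact: psd_triangle symform_psd _ _. Qed.

Lemma symnormZ a Z : symnorm al (a *: Z) = `|a| * symnorm al Z.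
Proof. exact: psd_sqrtZ symform_psd _ _. Qed.

Lemma symnorm0 : symnorm al 0 = 0.
Proof. by rewrite -(scale0r 0) symnormZ normr0 mul0r. Qed.

Lemma symnorm_sum (I : Type) (r : seq I) (P : pred I) (f : I -> symt V) :
  symnorm al (\sum_(i <- r | P i) f i) <= \sum_(i <- r | P i) symnorm al (f i).
Proof.
elim/big_ind2: _ => [|x a y b xa yb|//]; first by rewrite symnorm0.
by apply: le_trans (symnormD _ _) _; exact: lerD.
Qed.

Lemma symform_dpow v w m n : symform al (dpow v m) (dpow w n) =
  if m == n then al v w ^+ n / n`!%:R else 0.
Proof.
have [antil lin _ _] := tform_psd.
rewrite /symform !val_dpow (formZl antil) (formZr lin) tformE /form_word !size_nseq.
case: eqP => [->|_]; last by rewrite !mulr0.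
have -> : \prod_(xy <- zip (nseq n v) (nseq n w)) al xy.1 xy.2 = al v w ^+ n.
  elim: n => [|n IH]; first by rewrite /= big_nil.
  by rewrite /= big_cons IH exprS.
by rewrite fmorphV rmorph_nat mulKf ?fact_neq0 // mulrC.
Qed.

Lemma symnorm_dpow v n : symnorm al (dpow v n) = sqrtC (al v v ^+ n / n`!%:R).
Proof. by rewrite /symnorm symform_dpow eqxx. Qed.

Lemma tform_word s : tform al (tens s) (tens s) =
  (size s)`!%:R * \prod_(x <- s) al x x.
Proof.
rewrite tformE /form_word eqxx; congr (_ * _).
by elim: s => [|x s IH]; rewrite /= ?big_nil // !big_cons IH.
Qed.

(** Symmetrisation averages the permutations of a word, which all have the same
norm. *)
Lemma tnorm_Sym_le s :
  sqrtC (tform al (Defs.Sym (tens s)) (Defs.Sym (tens s))) <=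
  sqrtC (tform al (tens s) (tens s)).
Proof.
pose nrm X := sqrtC (tform al X X).
have N0 : nrm 0 = 0.
  by rewrite -(scale0r 0) /nrm (psd_sqrtZ tform_psd) normr0 mul0r.
rewrite SymE /sym_word (psd_sqrtZ tform_psd) -!/(nrm _).
rewrite normfV normr_nat mulrC ler_pdivrMr ?ltr0n ?fact_gt0 //.
have -> : nrm (tens s) * ((size s)`!)%:R = \sum_(p : 'S_(size s)) (nrm (tens s)).
  by rewrite sumr_const card_Sn mulr_natr.
apply: (@le_trans _ _ (\sum_(p : 'S_(size s))
    nrm (tens [seq s`_(p i) | i <- enum 'I_(size s)]))).
  elim/big_ind2: _ => [|x a y b xa yb|//]; first by rewrite N0.
  by apply: le_trans (psd_triangle tform_psd _ _) _; exact: lerD.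
apply: ler_sum => p _; rewrite /nrm !tform_word size_map size_enum_ord.
rewrite big_map big_enum /= (reindex_inj (@perm_inj _ (p^-1)%g)) /=.
under eq_bigr => i _ do rewrite permKV.
by rewrite [in X in _ <= X](big_nth 0) big_mkord.
Qed.

Lemma bin_le_exp2 n m : ('C(n, m) <= 2 ^ n)%N.
Proof.
elim: n m => [|n IH] [|m]; rewrite ?bin0 ?expn_gt0 //.
by rewrite binS expnS mul2n -addnn leq_add.
Qed.

(** The norm of v^i w^j involves (i + j)!, which exceeds i! j! by a binomial
coefficient; doubling v and w makes up for it. *)
Lemma symnorm_svee_dpow v w i j : symnorm al (svee (dpow v i) (dpow w j)) <=
  symnorm al (dpow (2 *: v) i) * symnorm al (dpow (2 *: w) j).
Proof.
have al0 u : 0 <= al u u by exact: hform_ge0.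
have al2 u : al (2 *: u) (2 *: u) = 4 * al u u.
  have [hl hr _ _] := hform_psd.
  by rewrite (formZl hl) (formZr hr) rmorph_nat; ring.
have nn (u : V) n : 0 <= al u u ^+ n / n`!%:R by rewrite divr_ge0 ?exprn_ge0.
rewrite svee_dpow symnormZ.
apply: le_trans (ler_wpM2l (normr_ge0 _) (tnorm_Sym_le _)) _.
rewrite !symnorm_dpow -sqrtCM ?nnegrE //.
have T0 X : 0 <= tform al X X by have [_ _ _ ->] := tform_psd.
rewrite -(@ler_pXn2r _ 2) //; last 2 first.
- by rewrite nnegrE mulr_ge0 // sqrtC_ge0.
- by rewrite nnegrE sqrtC_ge0 mulr_ge0.
rewrite exprMn !sqrtCK tform_word size_cat !size_nseq big_cat /=.
have prod_nseq u n : \prod_(x <- nseq n u) al x x = al u u ^+ n.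
  by elim: n => [|n IH]; rewrite /= ?big_nil // big_cons IH exprS.
rewrite !prod_nseq !al2 !exprMn normfV normrM !normr_nat.
rewrite -(bin_fact (leq_addr j i)) addKn.
pose q := al v v ^+ i / i`!%:R * (al w w ^+ j / j`!%:R).
rewrite [X in X <= _](_ : _ = 'C(i + j, i)%:R * q); last first.
  by rewrite /q !natrM; field; rewrite !fact_neq0.
rewrite [X in _ <= X](_ : _ = (4 ^ (i + j))%:R * q); last first.
  by rewrite /q natrX exprD; field; rewrite !fact_neq0.
apply: ler_wpM2r; first by rewrite mulr_ge0.
rewrite ler_nat (leq_trans (bin_le_exp2 _ _)) //.
by case: (i + j)%N => // n; rewrite leq_exp2r.
Qed.

End TensorForm.

Local Open Scope complex_scope.

(** * Series of complex numbers and rapid decay *)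

Section ComplexSeries.
Context (R : realType).
Local Notation C := R[i].

Lemma cvg_complex (u : nat -> C) (a b : R) :
  complex.Re (u n) @[n --> \oo] --> a -> complex.Im (u n) @[n --> \oo] --> b ->
  (u n : C^o) @[n --> \oo] --> (a +i* b : C^o).
Proof.
move=> ua ub; apply/cvgrPdist_lt => e e0.
have e'0 : 0 < complex.Re e / 2.
  by move: e0; rewrite ltcE => /andP[_ /=] ?; rewrite divr_gt0.
have eE : e = (complex.Re e)%:C by rewrite RRe_real // gtr0_real.
move/cvgrPdist_lt: ua => /(_ _ e'0) ua; move/cvgrPdist_lt: ub => /(_ _ e'0) ub.
near=> n.
have ea : `|a - complex.Re (u n)| < complex.Re e / 2 by near: n.
have eb : `|b - complex.Im (u n)| < complex.Re e / 2 by near: n.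
have -> : (a +i* b) - u n = (a - complex.Re (u n))%:C + 'i%C * (b - complex.Im (u n))%:C.
  by rewrite [in LHS](complexE (a +i* b)) [in LHS](complexE (u n)) /= !rmorphB /=; ring.
apply: le_lt_trans (ler_normD _ _) _.
rewrite normrM !normc_def /= !expr0n /= !addr0 !expr1n add0r sqrtr1 mul1r.
rewrite !sqrtr_sqr eE -rmorphD /= ltcR.
by rewrite [ltRHS](splitr (complex.Re e)) ltrD.
Unshelve. all: by end_near. Qed.

Lemma Re_sum (I : Type) (r : seq I) (F : I -> C) :
  complex.Re (\sum_(i <- r) F i) = \sum_(i <- r) complex.Re (F i).
Proof. by apply: (big_morph (@complex.Re R)) => [[? ?] [? ?]|]. Qed.

Lemma Im_sum (I : Type) (r : seq I) (F : I -> C) :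
  complex.Im (\sum_(i <- r) F i) = \sum_(i <- r) complex.Im (F i).
Proof. by apply: (big_morph (@complex.Im R)) => [[? ?] [? ?]|]. Qed.

(** R[i] inherits completeness from R through real and imaginary parts. *)
Lemma abs_cvg_series (u : nat -> C) (r : nat -> R) :
  (forall n, `|u n| <= (r n)%:C) -> cvgn (series r) ->
  cvgn (series (u : nat -> C^o)).
Proof.
move=> ur rcv.
have cvR (v : nat -> R) : (forall n, `|v n| <= r n) -> cvgn (series v).
  move=> vr; apply: normed_cvg; apply: series_le_cvg rcv => n; last exact: vr.
    exact: normr_ge0.
  exact: le_trans (normr_ge0 _) (vr n).
have cR : cvgn (series (fun n => complex.Re (u n))).
  by apply: cvR => n; rewrite -lecR (le_trans (normc_ge_Re _)).
have cI : cvgn (series (fun n => complex.Im (u n))).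
  apply: cvR => n /=; rewrite -lecR -normrN -ReiNIm (le_trans (normc_ge_Re _)) //.
  by rewrite normrM (normc_def 'i%C) /= expr0n expr1n add0r sqrtr1 mulr1.
apply/cvg_ex; exists (limn (series (fun n => complex.Re (u n))) +i*
  limn (series (fun n => complex.Im (u n)))).
apply: cvg_complex.
  by under eq_fun do rewrite /series /= Re_sum.
by under eq_fun do rewrite /series /= Im_sum.
Qed.

End ComplexSeries.

Section Rapid.
Context (R : realType).
Local Notation C := R[i].
Implicit Types (f g : nat -> C) (z : C).

(** For non-negative f: f decays faster than every geometric sequence. Natural
ratios r suffice and spare sign conditions. *)
Definition rapid f := forall r : nat, exists M : C, forall n, f n * r%:R ^+ n <= M.

Lemma norm_exp_term z n : `|z ^+ n / n`!%:R| = (exp_coeff (complex.Re `|z|) n)%:C.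
Proof.
have zE : (complex.Re `|z|)%:C = `|z| by rewrite RRe_real // ger0_real.
rewrite normf_div normrX normr_nat -zE; set x := complex.Re _.
by rewrite -[exp_coeff x n]/(x ^+ n / n`!%:R) rmorphM fmorphV rmorphXn rmorph_nat.
Qed.

Lemma expC_cvg z :
  (\sum_(k < n) z ^+ k / k`!%:R : C^o) @[n --> \oo] --> (expC z : C^o).
Proof.
have : cvgn (series (fun n => z ^+ n / n`!%:R : C^o)).
  apply: (@abs_cvg_series _ _ (exp_coeff (complex.Re `|z|))) => [n|].
    by rewrite norm_exp_term.
  exact: is_cvg_series_exp_coeff.
rewrite /expC => H.
have -> : (fun n => \sum_(k < n) z ^+ k / k`!%:R : C^o) =
    series (fun n => z ^+ n / n`!%:R : C^o) by rewrite seriesEord.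
exact: H.
Qed.

Lemma rapid_exp z : 0 <= z -> rapid (fun n => z ^+ n / n`!%:R).
Proof.
move=> z0 r; set b := complex.Re `|z * r%:R|.
have [M [_ HM]] := cvg_series_bounded (is_cvg_series_exp_coeff b).
exists (M + 1)%:C => n.
have -> : z ^+ n / n`!%:R * r%:R ^+ n = (exp_coeff b n)%:C.
  rewrite -norm_exp_term exprMn ger0_norm ?mulr_ge0 ?exprn_ge0 ?invr_ge0 //.
  by rewrite mulrAC.
rewrite lecR (le_trans (ler_norm _)) //; apply: HM => //.
by rewrite ltrDl.
Qed.

Lemma rapid_sqrt f : (forall n, 0 <= f n) -> rapid f -> rapid (fun n => sqrtC (f n)).
Proof.
move=> f0 fr r; have [M HM] := fr (r ^ 2)%N; exists (sqrtC M) => n.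
have -> : sqrtC (f n) * r%:R ^+ n = sqrtC (f n * (r ^ 2)%:R ^+ n).
  by rewrite natrX -exprM mulnC exprM sqrtCM ?nnegrE ?exprn_ge0 // exprCK ?exprn_ge0.
have fr0 : 0 <= f n * (r ^ 2)%:R ^+ n by rewrite mulr_ge0 ?exprn_ge0.
by rewrite ler_sqrtC ?nnegrE // (le_trans fr0).
Qed.

Lemma rapid_gauss z : rapid (fun i => `|gauss_coef z i|).
Proof.
move=> r; have [M HM] := rapid_exp (normr_ge0 z) (r ^ 2)%N; exists M => i.
have M0 : 0 <= M.
  by apply: le_trans (HM 0%N); rewrite mulr_ge0 ?divr_ge0 ?exprn_ge0.
rewrite /gauss_coef; case: ifP => oi; first by rewrite normr0 mul0r.
rewrite normf_div normrX normr_nat.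
have -> : r%:R ^+ i = (r ^ 2)%:R ^+ i./2 :> C.
  by rewrite natrX -exprM mul2n -{1}(odd_double_half i) oi.
exact: HM.
Qed.

(** The series of the coefficients of exp(z s^2) is the exponential series of z
with zeros interspersed. *)
Lemma gauss_sum_cvg z :
  (\sum_(i < n) gauss_coef z i : C^o) @[n --> \oo] --> (expC z : C^o).
Proof.
have -> : (fun n => \sum_(i < n) gauss_coef z i : C^o) =
    (fun n => \sum_(k < n) z ^+ k / k`!%:R : C^o) \o uphalf.
  apply/funext => -[|n] /=; first by rewrite !big_ord0.
  rewrite (big_ord_even (fun i => z ^+ i./2 / (i./2)`!%:R)).
  by apply: eq_bigr => k _; rewrite doubleK.
apply: (cvg_comp (G := \oo) uphalf _ _ (@expC_cvg z)).
move=> A [N _ NA]; exists N.*2 => // n /= Nn; apply: NA => /=.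
by rewrite uphalf_half -leq_double; lia.
Qed.

Lemma rapid_geometric f : (forall n, 0 <= f n) -> rapid f ->
  exists M : R, forall n, f n <= (M / 2 ^+ n)%:C.
Proof.
move=> f0 /(_ 2)[M HM]; exists (complex.Re M) => n.
have M0 : 0 <= M by apply: le_trans (HM 0%N); rewrite mulr_ge0 ?exprn_ge0.
rewrite rmorphM fmorphV rmorphXn rmorph_nat /= RRe_real ?ger0_real //.
by rewrite ler_pdivlMr ?exprn_gt0.
Qed.

Lemma rapid_cvg_series f : (forall n, 0 <= f n) -> rapid f ->
  cvgn (series (f : nat -> C^o)).
Proof.
move=> f0 fr; have [M HM] := rapid_geometric f0 fr.
apply: (@abs_cvg_series _ _ (geometric M 2^-1)) => [n|].
  by rewrite ger0_norm //= exprVn.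
by apply: is_cvg_geometric_series; rewrite ger0_norm ?invr_ge0 // invf_lt1 ?ltr1n.
Qed.

Definition rapid2 (F : nat -> nat -> C) :=
  forall r : nat, exists M : C, forall i j, F i j * r%:R ^+ (i + j) <= M.

Lemma rapid2_le F G : (forall i j, F i j <= G i j) -> rapid2 G -> rapid2 F.
Proof.
move=> FG Gr r; have [M HM] := Gr r; exists M => i j.
by apply: le_trans (HM i j); rewrite ler_wpM2r ?exprn_ge0.
Qed.

Lemma rapid2_mul f g : (forall n, 0 <= f n) -> (forall n, 0 <= g n) ->
  rapid f -> rapid g -> rapid2 (fun i j => f i * g j).
Proof.
move=> f0 g0 fr gr r; have [M HM] := fr r; have [N HN] := gr r; exists (M * N) => i j.
by rewrite exprD mulrACA ler_pM ?mulr_ge0 ?exprn_ge0.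
Qed.

Lemma expr2nM r n : (2 * r)%:R ^+ n = (2 ^ n)%:R * r%:R ^+ n :> C.
Proof. by rewrite natrM exprMn natrX. Qed.

(** An antidiagonal has n + 1 <= 2^n terms, which the bound for the ratio 2r
absorbs. *)
Lemma rapid2_antidiagonal F : (forall i j, 0 <= F i j) -> rapid2 F ->
  rapid (fun n => \sum_(i < n.+1) F i (n - i)%N).
Proof.
move=> F0 Fr r; have [M HM] := Fr (2 * r)%N; exists M => n.
have M0 : 0 <= M by apply: le_trans (HM 0%N 0%N); rewrite mulr_ge0 ?exprn_ge0.
have H (i : 'I_n.+1) : F i (n - i)%N * r%:R ^+ n <= M / (2 ^ n)%:R.
  rewrite ler_pdivlMr ?ltr0n ?expn_gt0 //.
  have := HM i (n - i)%N; rewrite subnKC -1?ltnS // expr2nM.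
  by rewrite mulrA mulrAC.
rewrite mulr_suml (le_trans (ler_sum (index_enum _) (fun i _ => H i))) //.
rewrite sumr_const card_ord -[leLHS]mulr_natr -mulrA ler_piMr //.
by rewrite mulrC ler_pdivrMr ?ltr0n ?expn_gt0 // mul1r ler_nat ltn_expl.
Qed.

(** With the ratio 8 each of the at most N^2 <= 4^N terms is at most M / 8^N. *)
Lemma rapid2_tail F : (forall i j, 0 <= F i j) -> rapid2 F ->
  exists M : R, forall N,
    \sum_(i < N) \sum_(j < N | (N <= i + j)%N) F i j <= (M / 2 ^+ N)%:C.
Proof.
move=> F0 /(_ 8)[M HM]; exists (complex.Re M) => N.
have M0 : 0 <= M by apply: le_trans (HM 0%N 0%N); rewrite mulr_ge0 ?exprn_ge0.
rewrite rmorphM fmorphV rmorphXn rmorph_nat /= RRe_real ?ger0_real //.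
have H (i j : 'I_N) : (N <= i + j)%N -> F i j <= M / 8 ^+ N.
  move=> Nij; rewrite ler_pdivlMr ?exprn_gt0 // (le_trans _ (HM i j)) //.
  by rewrite ler_wpM2l // ler_eXn2l ?ltr1n.
have M8 : 0 <= M / 8 ^+ N by rewrite divr_ge0 ?exprn_ge0.
apply: (@le_trans _ _ (\sum_(i < N) \sum_(j < N) M / 8 ^+ N)).
  apply: ler_sum => i _; rewrite big_mkcond; apply: ler_sum => j _ /=.
  by case: ifP => // /H.
rewrite !sumr_const !card_ord -!mulrnA -[leLHS]mulr_natr -mulrA ler_wpM2l //.
have p8 : 0 < 8 ^+ N :> C by rewrite exprn_gt0.
have p2 : 0 < 2 ^+ N :> C by rewrite exprn_gt0.
rewrite (ler_pdivrMl _ _ p8) (ler_pdivlMr _ _ p2).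
rewrite -!natrX -natrM ler_nat.
have -> : (8 ^ N = 2 ^ N * 2 ^ N * 2 ^ N)%N by rewrite -!expnMn.
by rewrite leq_mul // leq_mul // ltnW // ltn_expl.
Qed.

Lemma geometric_small (M : R) (e : C) : 0 < e ->
  \forall n \near \oo, (M / 2 ^+ n)%:C < e.
Proof.
move=> e0; have eE : e = (complex.Re e)%:C by rewrite RRe_real // gtr0_real.
have e'0 : 0 < complex.Re e by rewrite -ltcR -eE.
have := @cvg_geometric R M 2^-1; rewrite ger0_norm ?invr_ge0 // invf_lt1 ?ltr1n //.
move=> /(_ isT)/cvgr0Pnorm_lt/(_ _ e'0); apply: filterS => n /= H.
by rewrite eE ltcR (le_lt_trans _ H) // exprVn ler_norm.
Qed.

End Rapid.

(** * Limits in the completion *)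

Lemma sum_antidiagonal (W : nmodType) (F : nat -> nat -> W) N :
  \sum_(n < N) \sum_(i < n.+1) F i (n - i)%N =
  \sum_(i < N) \sum_(j < N | (i + j < N)%N) F i j.
Proof.
have -> : \sum_(i < N) \sum_(j < N | (i + j < N)%N) F i j =
    \sum_(i < N) \sum_(j < N - i) F i j.
  apply: eq_bigr => i _; rewrite (big_ord_widen N (F i)) ?leq_subr //.
  by apply: eq_bigl => j; rewrite ltn_subRL.
elim: N => [|N IH]; first by rewrite !big_ord0.
rewrite big_ord_recr {}IH /= [RHS]big_ord_recr /= subSnn.
under [X in _ = X + _]eq_bigr => i _.
  rewrite subSn; last exact: ltnW.
  rewrite big_ord_recr /=; over.
rewrite big_split /= [X in _ + X]big_ord_recr /= -addrA; congr (_ + _).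
by rewrite big_ord1 subnn.
Qed.

Section Limits.
Context (R : realType) (V E : tvsType R[i]) (iota : {linear symt V -> E}).
Hypothesis iotaP : is_completion iota.
Local Notation C := R[i].

Lemma iota_cvg0 (u : nat -> symt V) :
  (forall al (e : C), 0 < e -> \forall n \near \oo, symnorm al (u n) < e) ->
  iota (u n) @[n --> \oo] --> (0 : E).
Proof.
move=> u0 U U0.
have [k [al [e [e0 H]]]] : sym_nbhs0 (iota @^-1` U).
  by apply/(completion_embedding iotaP); exists U.
have : \forall n \near \oo, forall i : 'I_k, symnorm (al i) (u n) < e.
  by apply: filter_forall => i; exact: u0.
by apply: filterS => n /H.
Qed.

(** The partial sums from N on differ by at most twice the tail
\sum_(k >= N) M / 2^k = 2 M / 2^N. *)
Lemma partial_sums_cauchy al (u : nat -> symt V) (e : C) :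
  rapid (fun n => symnorm al (u n)) -> 0 < e ->
  \forall N \near \oo, forall m n, (N <= m)%N -> (N <= n)%N ->
    symnorm al (\sum_(k < m) u k - \sum_(k < n) u k) < e.
Proof.
move=> ur e0; have [M HM] := rapid_geometric (fun n => symnorm_ge0 al (u n)) ur.
pose s n := \sum_(k < n) u k.
have M0 : 0 <= M.
  rewrite -ler0c (le_trans (symnorm_ge0 al (u 0%N))) // (le_trans (HM 0%N)) //.
  by rewrite expr0 divr1.
have tail N d : symnorm al (s (N + d)%N - s N) <=
    (2 * M / 2 ^+ N - 2 * M / 2 ^+ (N + d))%:C.
  elim: d => [|d IH]; first by rewrite addn0 !subrr symnorm0.
  rewrite addnS {1}/s big_ord_recr /= addrAC.
  apply: le_trans (symnormD _ _ _) _; apply: le_trans (lerD IH (HM (N + d)%N)) _.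
  rewrite -rmorphD lecR le_eqVlt; apply/orP; left; apply/eqP.
  by rewrite exprS; field; rewrite !expf_neq0.
have le_tail N m : (N <= m)%N -> symnorm al (s m - s N) <= (2 * M / 2 ^+ N)%:C.
  move=> /subnKC <-; apply: le_trans (tail _ _) _.
  by rewrite lecR gerBl divr_ge0 ?mulr_ge0 ?exprn_ge0.
apply: filterS (geometric_small (4 * M) e0) => N He m n Nm Nn.
rewrite (_ : _ - _ = (s m - s N) - (s n - s N)); last by rewrite opprB addrA subrK.
apply: le_lt_trans He.
have -> : 4 * M / 2 ^+ N = 2 * M / 2 ^+ N + 2 * M / 2 ^+ N by rewrite -!mulrDl -natrD.
rewrite rmorphD (le_trans (symnormD _ _ _)) // lerD ?le_tail //.
by rewrite -scaleN1r symnormZ normrN1 mul1r le_tail.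
Qed.

Lemma abs_cvg_iota (u : nat -> symt V) : (forall al, rapid (fun n => symnorm al (u n))) ->
  exists x : E, iota (\sum_(k < n) u k) @[n --> \oo] --> x.
Proof.
move=> ur; apply: (completion_complete iotaP) => U U0.
have [k [al [e [e0 H]]]] : sym_nbhs0 (iota @^-1` U).
  by apply/(completion_embedding iotaP); exists U.
have [N HN] : exists N, forall m n i, (N <= m)%N -> (N <= n)%N ->
    symnorm (al i) (\sum_(k < m) u k - \sum_(k < n) u k) < e.
  have : \forall N \near \oo, forall i m n, (N <= m)%N -> (N <= n)%N ->
      symnorm (al i) (\sum_(k < m) u k - \sum_(k < n) u k) < e.
    apply: filter_forall => i; exact: partial_sums_cauchy.
  by move=> [N _ HN]; exists N => m n i; apply: HN => /=.
exists [set iota (\sum_(k < n) u k) | n in [set n | (N <= n)%N]].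
  by exists N => // n Nn; exists n.
move=> _ _ [m Nm <-] [n Nn <-]; rewrite -linearB; apply: H => i.
exact: HN.
Qed.

Lemma cvg_tvsD (f g : nat -> E) (a b : E) :
  f n @[n --> \oo] --> a -> g n @[n --> \oo] --> b ->
  f n + g n @[n --> \oo] --> a + b.
Proof.
move=> fa gb; apply: (@continuous2_cvg _ _ _ _ _ _ f g (fun x y => x + y)) => //.
exact: (@add_continuous _ (a, b)).
Qed.

Lemma cvg_tvsZ (f : nat -> C) (g : nat -> E) (a : C) (b : E) :
  (f n : C^o) @[n --> \oo] --> (a : C^o) -> g n @[n --> \oo] --> b ->
  f n *: g n @[n --> \oo] --> a *: b.
Proof.
move=> fa gb; apply: (@continuous2_cvg _ C^o E E _ _ f g (fun x y => x *: y)) => //.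
exact: (@scale_continuous _ _ (a, b)).
Qed.

(** The partial sums over a square and over a triangle of side N differ by the
terms with N <= i + j, whose sum tends to 0. *)
Lemma cvg_square_antidiagonal (X : nat -> nat -> symt V) (x : E) :
  (forall al, rapid2 (fun i j => symnorm al (X i j))) ->
  iota (\sum_(i < N) \sum_(j < N) X i j) @[N --> \oo] --> x ->
  iota (\sum_(n < N) \sum_(i < n.+1) X i (n - i)%N) @[N --> \oo] --> x.
Proof.
move=> Xr Xx.
pose T N := \sum_(i < N) \sum_(j < N | (N <= i + j)%N) X i j.
have T0 : iota (- T N) @[N --> \oo] --> (0 : E).
  apply: iota_cvg0 => al e e0.
  have [M HM] := rapid2_tail (fun i j => symnorm_ge0 al (X i j)) (Xr al).
  apply: filterS (geometric_small M e0) => N; apply: le_lt_trans.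
  rewrite -scaleN1r symnormZ normrN1 mul1r (le_trans _ (HM N)) //.
  rewrite (le_trans (symnorm_sum _ _ _ _)) // ler_sum // => i _.
  exact: symnorm_sum.
have := cvg_tvsD Xx T0; rewrite addr0; apply: cvg_trans; apply: near_eq_cvg.
apply: nearW => N; rewrite sum_antidiagonal -linearD; congr (iota _).
rewrite /T -sumrB; apply: eq_bigr => i _.
rewrite [X in X - _](bigID (fun j : 'I_N => (i + j < N)%N)) /=.
rewrite (eq_bigl (fun j : 'I_N => (N <= i + j)%N) (P1 := fun j : 'I_N => ~~ (i + j < N)%N)).
  by rewrite addrK.
by move=> j; rewrite -leqNgt.
Qed.

End Limits.

(** * Exponentials *)

Section Decay.
Context (R : realType) (V : tvsType R[i]) (al : hform V).
Local Notation C := R[i].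
Implicit Types (v w : V).

Lemma rapid_dpow v : rapid (fun n => symnorm al (dpow v n)).
Proof.
have v0 : 0 <= al v v by exact: hform_ge0.
rewrite (funext (symnorm_dpow al v)); apply: rapid_sqrt; last exact: rapid_exp.
by move=> n; rewrite divr_ge0 ?exprn_ge0.
Qed.

Lemma rapid2_gauss_dpow z v :
  rapid2 (fun i j => symnorm al (gauss_coef z i *: dpow v j)).
Proof.
apply: (@rapid2_le _ _ (fun i j => `|gauss_coef z i| * symnorm al (dpow v j))).
  by move=> i j; rewrite symnormZ.
apply: rapid2_mul (rapid_gauss z) (rapid_dpow v) => n; first exact: normr_ge0.
exact: symnorm_ge0.
Qed.

(** A product has min(k, l) + 1 <= 2^(k + l) terms; each is bounded by a
product of three rapidly decaying factors of degrees 2t, k - t and l - t in s,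
and these degrees add up to k + l. *)
Lemma rapid2_star_dpow (Lam : V -> V -> C) v w :
  (forall w a u v, Lam (a *: u + v) w = a * Lam u w + Lam v w) ->
  (forall w a u v, Lam w (a *: u + v) = a * Lam w u + Lam w v) ->
  rapid2 (fun k l => symnorm al (star Lam (dpow v k) (dpow w l))).
Proof.
move=> Ll Lr r.
have [A HA] := rapid_exp (normr_ge0 (Lam v w)) ((2 * r) ^ 2)%N.
have [F HF] := rapid_dpow (2 *: v) (2 * r)%N.
have [G HG] := rapid_dpow (2 *: w) (2 * r)%N.
exists (A * (F * G)) => k l.
have A0 : 0 <= A by apply: le_trans (HA 0%N); rewrite mulr_ge0 ?divr_ge0 ?exprn_ge0.
have F0 : 0 <= F by apply: le_trans (HF 0%N); rewrite mulr_ge0 ?exprn_ge0 ?symnorm_ge0.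
have G0 : 0 <= G by apply: le_trans (HG 0%N); rewrite mulr_ge0 ?exprn_ge0 ?symnorm_ge0.
rewrite (star_dpow Ll Lr _ _ (ltnSn (minn k l))).
set Y := \sum_(t < _) _.
have H : symnorm al Y * (2 * r)%:R ^+ (k + l) <= A * (F * G) * (minn k l).+1%:R.
  have -> : A * (F * G) * (minn k l).+1%:R = \sum_(t < (minn k l).+1) A * (F * G).
    by rewrite sumr_const card_ord mulr_natr.
  apply: le_trans (ler_wpM2r _ (symnorm_sum _ _ _ _)) _; first by rewrite exprn_ge0.
  rewrite mulr_suml; apply: ler_sum => t _.
  case: ifP => [/andP[tk tl]|_]; last by rewrite symnorm0 mul0r !mulr_ge0.
  rewrite symnormZ normf_div normrX normr_nat.
  have -> : (2 * r)%:R ^+ (k + l) =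
      ((2 * r) ^ 2)%:R ^+ t * ((2 * r)%:R ^+ (k - t) * (2 * r)%:R ^+ (l - t)) :> C.
    by rewrite natrX -exprM -!exprD; congr (_ ^+ _); lia.
  rewrite mulrACA ler_pM ?mulr_ge0 ?divr_ge0 ?exprn_ge0 ?symnorm_ge0 //.
  apply: (@le_trans _ _
    (symnorm al (dpow (2 *: v) (k - t)) * symnorm al (dpow (2 *: w) (l - t)) *
     ((2 * r)%:R ^+ (k - t) * (2 * r)%:R ^+ (l - t)))).
    by rewrite ler_wpM2r ?mulr_ge0 ?exprn_ge0 // symnorm_svee_dpow.
  by rewrite mulrACA ler_pM ?mulr_ge0 ?exprn_ge0 ?symnorm_ge0.
have p2 : 0 < (2 ^ (k + l))%:R :> C by rewrite ltr0n expn_gt0.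
rewrite -(ler_pM2r p2) -mulrA [_ * (2 ^ _)%:R in leLHS]mulrC -expr2nM.
apply: le_trans H _; rewrite ler_wpM2l ?mulr_ge0 // ler_nat.
by apply: leq_ltn_trans (ltn_expl (k + l) _); lia.
Qed.

End Decay.

Section Exponentials.
Context (R : realType) (V E : tvsType R[i]) (iota : {linear symt V -> E}).
Hypothesis iotaP : is_completion iota.
Context (Lam : {bilinear V -> V -> R[i]^o}) (starL vee : E -> E -> E).
Hypothesis starL_ext : extends2 iota (star Lam) starL.
Hypothesis vee_ext : extends2 iota (@svee _ V) vee.
Local Notation C := R[i].
Local Notation one := (iota (sone V)).
Local Notation vec v := (iota (svec v)).
Local Notation Exp v := (exp_prod vee one (vec v)).

Let Ll w a u v : Lam (a *: u + v) w = a * Lam u w + Lam v w.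
Proof. by rewrite linearPl. Qed.
Let Lr w a u v : Lam w (a *: u + v) = a * Lam w u + Lam w v.
Proof. by rewrite linearPr. Qed.

Lemma exp_prodP (mul : E -> E -> E) (x l : E) :
  series (exp_term mul one x) @ \oo --> l -> exp_prod mul one x = l.
Proof.
move=> sl.
have := xgetPex 0 (ex_intro (fun s => series (exp_term mul one x) @ \oo --> s) l sl).
by move=> H; apply: cvg_unique H sl; exact: completion_hausdorff iotaP.
Qed.

Lemma exp_term_vee v n : exp_term vee one (vec v) n = iota (dpow v n).
Proof.
have -> : dpow v n = (n`!%:R)^-1 *: iter n (svee (svec v)) (sone V).
  by rewrite iter_svee scalerA mulVf ?scale1r ?fact_neq0.
rewrite /exp_term linearZ; congr (_ *: _).
by elim: n => [//|n IH]; rewrite !iterS IH vee_ext.2.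
Qed.

Lemma exp_term_star v n :
  exp_term starL one (vec v) n = iota (hermite Lam v n).
Proof.
have -> : hermite Lam v n = (n`!%:R)^-1 *: iter n (star Lam (svec v)) (sone V).
  by rewrite (iter_star Ll Lr) scalerA mulVf ?scale1r ?fact_neq0.
rewrite /exp_term linearZ; congr (_ *: _).
by elim: n => [//|n IH]; rewrite !iterS IH starL_ext.2.
Qed.

Lemma series_iota (u : nat -> E) (x : nat -> symt V) : (forall n, u n = iota (x n)) ->
  series u = (fun n => iota (\sum_(k < n) x k)).
Proof.
move=> ux; rewrite seriesEord; apply/funext => n /=.
by rewrite linear_sum; apply: eq_bigr => k _; exact: ux.
Qed.

Lemma Exp_cvg v : iota (\sum_(k < n) dpow v k) @[n --> \oo] --> Exp v.
Proof.
have [l Hl] := abs_cvg_iota iotaP (fun al => rapid_dpow al v).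
by rewrite (@exp_prodP _ _ l) // (series_iota (exp_term_vee v)).
Qed.

(** exp(z s^2) exp(s v) at s = 1: the square partial sums factor into the two
exponential series, and the triangular ones are the Taylor polynomials. *)
Lemma gauss_Exp_cvg z v :
  iota (\sum_(n < N) \sum_(i < n.+1) gauss_coef z i *: dpow v (n - i)) @[N --> \oo] -->
  expC z *: Exp v.
Proof.
apply: (cvg_square_antidiagonal iotaP (X := fun i j => gauss_coef z i *: dpow v j)).
  by move=> al; exact: rapid2_gauss_dpow.
have := cvg_tvsZ (@gauss_sum_cvg _ z) (@Exp_cvg v).
apply: cvg_trans; apply: near_eq_cvg; apply: nearW => N.
rewrite -linearZ scaler_suml; congr (iota _); apply: eq_bigr => i _.
by rewrite scaler_sumr.
Qed.

Lemma star_exp_series v :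
  series (exp_term starL one (vec v)) @ \oo --> expC (Lam v v / 2) *: Exp v.
Proof.
rewrite (series_iota (exp_term_star v)); exact: gauss_Exp_cvg.
Qed.

(** The square partial sums of the products v^[k] * w^[l] tend to the product of
the exponentials by continuity; the triangular ones are the partial sums of
exp(s^2 Lam(v, w)) exp(s (v + w)) at s = 1. *)
Lemma star_Exp v w : starL (Exp v) (Exp w) = expC (Lam v w) *: Exp (v + w).
Proof.
have H1 : iota (\sum_(k < N) \sum_(l < N) star Lam (dpow v k) (dpow w l)) @[N --> \oo]
    --> starL (Exp v) (Exp w).
  have : starL (iota (\sum_(k < N) dpow v k)) (iota (\sum_(k < N) dpow w k)) @[N --> \oo]
      --> starL (Exp v) (Exp w).
    apply: (@continuous2_cvg _ E E E _ _ _ _ starL _ _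
      (starL_ext.1 (Exp v, Exp w)) (@Exp_cvg v) (@Exp_cvg w)).
  apply: cvg_trans; apply: near_eq_cvg; apply: nearW => N /=.
  rewrite starL_ext.2; congr (iota _).
  rewrite (linear_map_sum (star_linear_l Ll Lr _)); apply: eq_bigr => k _.
  by rewrite (linear_map_sum (star_linear_r Ll Lr _)).
have := cvg_square_antidiagonal iotaP
  (fun al => rapid2_star_dpow al v w Ll Lr) H1.
under eq_fun => N.
  under eq_bigr => n _ do rewrite (star_dpow_antidiagonal Ll Lr).
  over.
move=> H2; apply: cvg_unique H2 (@gauss_Exp_cvg _ _).
exact: completion_hausdorff iotaP.
Qed.

Lemma form_Exp (al : hform V) (form : E -> E -> C) v w :
  extends_form iota (symform al) form -> form (Exp v) (Exp w) = expC (al v w).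
Proof.
move=> [form_cont formE].
have [hl hr _ _] := symform_psd al.
have H : (form (iota (\sum_(k < N) dpow v k)) (iota (\sum_(k < N) dpow w k)) : C^o)
    @[N --> \oo] --> (form (Exp v) (Exp w) : C^o).
  apply: (@continuous2_cvg _ E E C^o _ _ _ _ form _ _
    (form_cont (Exp v, Exp w)) (@Exp_cvg v) (@Exp_cvg w)).
apply: cvg_unique H _; first exact: norm_hausdorff.
have := @expC_cvg _ (al v w); apply: cvg_trans; apply: near_eq_cvg; apply: nearW => N.
rewrite formE (form_suml hl); apply: eq_bigr => k _.
rewrite (form_sumr hr) (bigD1 k) //= big1 => [|j jk].
  by rewrite symform_dpow eqxx addr0.
by rewrite symform_dpow ifN // eq_sym.
Qed.

Lemma symstar_dpow (bar : cinvolution V) v n :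
  symstar bar (dpow v n) = dpow (bar v) n.
Proof.
apply: val_inj; rewrite -[LHS]/(tstar bar (\val (dpow v n))) !val_dpow.
have t0 : tstar bar (0 : talg V) = 0.
  have := tstar_antilinear bar (-1) 0 (0 : talg V).
  by rewrite scaler0 addr0 rmorphN1 scaleN1r addNr.
rewrite -[_ *: _ in LHS]addr0 tstar_antilinear t0 addr0 tstarE fmorphV rmorph_nat.
by rewrite map_nseq rev_nseq.
Qed.

Lemma star_Exp_bar (bar : cinvolution V) (st : E -> E) v :
  extends1 iota (symstar bar) st -> st (Exp v) = Exp (bar v).
Proof.
move=> [st_cont stE].
have H : st (iota (\sum_(k < N) dpow v k)) @[N --> \oo] --> st (Exp v).
  by apply: (@continuous_cvg _ E E _ _ _ st _ (st_cont _) (@Exp_cvg v)).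
apply: cvg_unique H _; first exact: completion_hausdorff iotaP.
have := @Exp_cvg (bar v); apply: cvg_trans; apply: near_eq_cvg; apply: nearW => N.
rewrite stE; congr (iota _).
have sD X Y : symstar bar (X + Y) = symstar bar X + symstar bar Y.
  by apply: val_inj; rewrite /= -[\val X]scale1r tstar_antilinear rmorph1 !scale1r.
have s0 : symstar bar 0 = 0.
  by apply: (addrI (symstar bar 0)); rewrite -sD !addr0.
by rewrite (big_morph _ sD s0); apply: eq_bigr => k _; rewrite symstar_dpow.
Qed.

Lemma abs_cvg_star_exp (al : hform V) (form : E -> E -> C) v :
  extends_form iota (symform al) form ->
  cvgn (series (fun n => form_norm form (exp_term starL one (vec v) n) : C^o)).
Proof.
move=> [_ formE].
have -> : (fun n => form_norm form (exp_term starL one (vec v) n) : C^o) =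
    (fun n => symnorm al (hermite Lam v n) : C^o).
  by apply/funext => n; rewrite exp_term_star /form_norm formE.
apply: rapid_cvg_series; first by move=> n; exact: symnorm_ge0.
have := rapid2_antidiagonal (fun i j => symnorm_ge0 al _)
  (rapid2_gauss_dpow al (Lam v v / 2) v).
move=> H r; have [M HM] := H r; exists M => n; apply: le_trans (HM n).
by rewrite ler_wpM2r ?exprn_ge0 // symnorm_sum.
Qed.

End Exponentials.

Theorem proposition3p35 (R : realType) (V : tvsType R[i])
    (V_hausdorff : hausdorff_space V)
    (V_cofinal : hilbert_seminorms_cofinal V)
    (E : tvsType R[i]) (iota : {linear symt V -> E})
    (E_completion : is_completion iota)
    (Lam : {bilinear V -> V -> R[i]^o})
    (Lam_continuous : continuous (fun p : V * V => Lam p.1 p.2))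
    (starL vee : E -> E -> E)
    (starL_ext : extends2 iota (star Lam) starL)
    (vee_ext : extends2 iota (@svee _ V) vee)
    (form : hform V -> E -> E -> R[i])
    (form_ext : forall al, extends_form iota (symform al) (form al)) :
  let one : E := iota (sone V) in
  let vec (v : V) : E := iota (svec v) in
  [/\ forall v,
        [/\ forall al, cvgn (series (fun n =>
               form_norm (form al) (exp_term starL one (vec v) n) : R[i]^o)),
            series (exp_term starL one (vec v)) @ \oo -->
              exp_prod starL one (vec v) &
            exp_prod starL one (vec v) =
              expC (Lam v v / 2) *: exp_prod vee one (vec v)],
      forall v w,
        starL (exp_prod vee one (vec v)) (exp_prod vee one (vec w)) =
          expC (Lam v w) *: exp_prod vee one (vec (v + w)),
      forall v w al,
        form al (exp_prod vee one (vec v)) (exp_prod vee one (vec w)) =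
          expC (al v w) &
      forall (bar : cinvolution V) (st : E -> E),
        extends1 iota (symstar bar) st ->
        forall v, st (exp_prod vee one (vec v)) = exp_prod vee one (vec (bar v))].
Proof.
move=> one vec; split=> [v|v w|v w al|bar st stP v].
- have starP := @star_exp_series _ _ _ _ E_completion _ _ _ starL_ext vee_ext v.
  have starE := exp_prodP E_completion starP.
  split=> [al||]; last exact: starE.
    exact: (abs_cvg_star_exp (v := v) starL_ext (form_ext al)).
  by rewrite starE; exact: starP.
- exact: star_Exp.
- exact: form_Exp.
- exact: star_Exp_bar.
Qed.
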